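(* Let $n\ge 1$ and $N\ge 0$ be integers and let $a_1,\dots,a_{n-1},b,z_1,\dots,z_n$ be nonzero complex numbers. Then $$\sum_{\substack{y_1+\dots+y_n=N\\ y_1,\dots,y_n\geq 0}} \frac{\Delta(zq^y)}{\Delta(z)}\prod_{1\leq j<k\leq n}\frac{1}{(z_jz_k)_{y_j+y_k}} \prod_{k=1}^n\frac{q^{\binom{y_k}2}z_k^{y_k}\prod_{j=1}^{n-1} (z_ka_j,z_k/a_j)_{y_k}}{(bz_k,q^{1-N}z_k/b)_{y_k}\prod_{j=1}^n(qz_k/z_j)_{y_k}} =(-q^{N-1}b)^N\frac{\prod_{k=1}^{n-1}(ba_k,b/a_k)_N} {(q)_N\prod_{k=1}^n(bz_k,b/z_k)_N},$$ the sum being over integers $y_1,\dots,y_n$.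
   Context: Fix $p\in\mathbb C$ with $|p|<1$ and $q\in\mathbb C\setminus\{0\}$. For $x\neq 0$ put $\theta(x)=\prod_{j=0}^\infty(1-p^jx)(1-p^{j+1}/x)$ (so $\theta(x)=1-x$ when $p=0$). The elliptic Pochhammer symbol is $(a)_k=\theta(a)\theta(aq)\cdots\theta(aq^{k-1})$ for integers $k\ge 0$, with $(a)_0=1$, and $(a_1,\dots,a_r)_k=(a_1)_k\cdots(a_r)_k$. For $z=(z_1,\dots,z_n)$, the elliptic Vandermonde determinant is $\Delta(z)=\prod_{1\le j<k\le n}z_j\,\theta(z_k/z_j)$, and $zq^y=(z_1q^{y_1},\dots,z_nq^{y_n})$. Standing assumption: all expressions are well-defined, i.e. the parameters are such that no denominator occurring on either side vanishes. *)

(* Defs.v *)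
From mathcomp Require Import all_boot all_order all_algebra.
From mathcomp Require Import complex.
From mathcomp Require Import all_classical all_reals all_analysis.

Set Implicit Arguments.
Unset Strict Implicit.
Unset Printing Implicit Defensive.

Import Order.TTheory GRing.Theory Num.Theory.
Import numFieldNormedType.Exports.

Local Open Scope classical_set_scope.
Local Open Scope ring_scope.

Section Elliptic.
Variable R : realType.
Implicit Types (p q x a : R[i]).

(* The infinite product, as the limit in R[i] of its partial products; the
   topology is the one of the norm [`|_|], carried by the alias [R[i]^o]. For
   [p = 0] the convention [0 ^+ 0 = 1] makes it [1 - x]. *)
Definition theta p x : R[i] :=
  lim ((fun m : nat =>
    \prod_(j < m) ((1 - p ^+ j * x) * (1 - p ^+ j.+1 / x)) : R[i]^o) @ \oo).

Definition epoch p q a (k : nat) : R[i] := \prod_(i < k) theta p (a * q ^+ i).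

Definition vandermonde p (n : nat) (z : 'I_n -> R[i]) : R[i] :=
  \prod_(j < n) \prod_(k < n | (j < k)%N) (z j * theta p (z k / z j)).

End Elliptic.

(* Main.v *)
(* After the denominators involving [b] are cleared, the identity is proved by
   induction on [N]. For [|y| = N] consider f(c) = prod_k th(c z_k q^(y_k)).
   Type A (Frobenius) Lagrange interpolation expands f(b) in the values f(1/z_m).
   The value f(1/z_m) is 0 when [y_m = 0]; otherwise multiplying the summand of
   index [y] by it gives a multiple of the summand of index [y - e_m] for [N - 1]
   and the variables [z q^(e_m)]. With [b] replaced by [b q], the sum over [y - e_m]
   does not depend on [m] by induction, and what remains is a type C (even)
   Lagrange interpolation of prod_j th(b a_j) th(b / a_j) at the nodes [z_m].

   Both interpolation formulas follow from th(1/x) = - th(x)/x and Weierstrass'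
   three-term relation. The latter says that th(x y) th(x/y) is a kernel of rank
   two, which is read off the Jacobi triple product: the finite form of the triple
   product shows that the partial products of th(x y) th(x/y) are within O(r^M)
   of kernels of rank two. *)

Require Import Defs.
From mathcomp Require Import all_boot all_order all_algebra.
From mathcomp Require Import complex.
From mathcomp Require Import all_classical all_reals all_analysis.
From mathcomp Require Import ring lra zify.

Set Implicit Arguments.
Unset Strict Implicit.
Unset Printing Implicit Defensive.

Import Order.TTheory GRing.Theory Num.Theory.
Import numFieldNormedType.Exports.

Local Open Scope ring_scope.

(** The factors involving b are cleared because the induction leaves the range where they are known
    to be nonzero: replacing b by b q and z_m by z_m q turns (b z_m)_(N+1) into (b z_m q^2)_N, whose
    last factor th(b z_m q^(N+1)) is not covered by the assumptions. In cleared form b only has to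
    be nonzero, and the induction divides only by factors free of b. The nonvanishing of those is
    stable under the shift of z_m, since each shift consumes one power of q while N drops by one.
    The ground field is algebraically closed because merging two nodes in type A interpolation takes
    a square root. *)

Lemma bin2_int (n : nat) : n%:Z * n%:Z - n%:Z = (2 * 'C(n, 2))%:Z.
Proof. by elim: n => // n IH; rewrite binS bin1; lia. Qed.

(** * Theta-function interpolation *)

Section Interpolation.
Variables (K : fieldType) (I : finType) (X : Type).
Variables (e : I -> X -> K) (x : I -> X) (kappa : I -> X -> K).
Implicit Types (S : {set I}) (f : X -> K).

(* [kappa] is the extra factor of type A interpolation, where the product of the
   zeros is prescribed; in type C it is 1. *)
Definition interp S f c :=
  \sum_(m in S) f (x m) * kappa m c * \prod_(j in S :\ m) (e j c / e j (x m)).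

(** The term at [k] dies because [e k] vanishes there; in the other terms [e k (x m)] cancels a
    denominator. Removing a node in this way is the inductive step of both interpolation
    formulas. *)
Lemma interp_mul k S f c : k \in S -> e k (x k) = 0 ->
    (forall m, m \in S :\ k -> e k (x m) != 0) ->
  interp S (fun c => e k c * f c) c = e k c * interp (S :\ k) f c.
Proof.
move=> kS ekk ekm; rewrite /interp (big_setD1 k) //= ekk !mul0r add0r mulr_sumr.
apply: eq_bigr => m mSk.
have kSm : k \in S :\ m.
  by move: mSk; rewrite !inE kS eq_sym andbT => /andP[].
rewrite (big_setD1 k) //=.
have -> : S :\ m :\ k = S :\ k :\ m by apply/setP => i; rewrite !inE andbCA.
have := ekm _ mSk; set P := \prod_(_ in _) _ => h.
by rewrite -[LHS]mulrA; field.
Qed.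

Lemma interp_lin S f f1 f2 c (al be : K) :
    (forall m, m \in S -> f (x m) = al * f1 (x m) + be * f2 (x m)) ->
  interp S f c = al * interp S f1 c + be * interp S f2 c.
Proof.
move=> h; rewrite /interp !mulr_sumr -big_split; apply: eq_bigr => m mS /=.
by rewrite h //; ring.
Qed.

End Interpolation.

(** * Consequences of the inversion and three-term relations *)

Section EllipticAlgebra.
Variables (K : numClosedFieldType) (th : K -> K).
Hypothesis thV : forall x, x != 0 -> th x^-1 = - x^-1 * th x.
Definition thpm x y := th (x * y) * th (x / y).
(* Weierstrass' relation, as the Pluecker relation of the antisymmetric kernel
   [thpm x y / x] of rank two. *)
Hypothesis thpm_plucker : forall x y u v, x != 0 -> y != 0 -> u != 0 -> v != 0 ->
  thpm x y / x * (thpm u v / u) - thpm x u / x * (thpm y v / y)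
  + thpm x v / x * (thpm y u / y) = 0.

Lemma th1 : th 1 = 0.
Proof.
have := thV (oner_neq0 K); rewrite invr1 mulN1r => h.
apply/eqP; have : th 1 *+ 2 == 0 by rewrite mulr2n {1}h addNr.
by rewrite mulrn_eq0.
Qed.

Lemma th_div_neq0 x y : x != 0 -> y != 0 -> th (x / y) != 0 -> th (y / x) != 0.
Proof.
move=> x0 y0 h; rewrite -[y / x]invf_div thV ?mulf_neq0 ?invr_eq0 //.
by rewrite oppr_eq0 invr_eq0 mulf_neq0 ?invr_eq0.
Qed.

Lemma thpmC x y : x != 0 -> y != 0 -> thpm y x = - (y / x) * thpm x y.
Proof.
move=> x0 y0; rewrite /thpm (mulrC y x) -[y / x]invf_div thV ?mulf_neq0 ?invr_eq0 //.
by rewrite invf_div; ring.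
Qed.

(** By rank two, [thpm x a] lies in the span of [thpm x k] and [thpm x l] as a function of [x];
    setting [x] to [l] or [k] yields the coefficients. *)
Lemma thpm_expand a k l x : a != 0 -> k != 0 -> l != 0 -> thpm k l != 0 -> x != 0 ->
  thpm x a = thpm l a / thpm l k * thpm x k + thpm k a / thpm k l * thpm x l.
Proof.
move=> a0 k0 l0 kl0 x0.
have lk0 : thpm l k != 0 by rewrite thpmC // mulf_neq0 // oppr_eq0 mulf_neq0 ?invr_eq0.
have := thpm_plucker x0 a0 k0 l0.
rewrite (thpmC l0 a0) (thpmC k0 a0) (thpmC l0 k0).
set A := thpm x a; set B := thpm x k; set C := thpm x l.
move=> h; apply/eqP; rewrite -subr_eq0; apply/eqP.
have -> : A - (thpm l a / thpm l k * B + thpm k a / (- (k / l) * thpm l k) * C)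
 = (- x * l / thpm l k) * (A / x * (- (k / l) * thpm l k / k) - B / x * (- (a / l) * thpm l a / a) +
      C / x * (- (a / k) * thpm k a / a)).
  by field; rewrite a0 k0 l0 x0 lk0 ?mulf_neq0 ?oppr_eq0 ?oner_neq0.
by rewrite h mulr0.
Qed.

(* The case of two nodes; it becomes [thpm_expand] after rescaling by a square
   root of the common product [wk * wl]. *)
Lemma th_merge zk zl wk wl Q : zk != 0 -> zl != 0 -> wk != 0 -> Q != 0 ->
    wk * wl = zk * zl * Q -> th Q != 0 -> th (zk / zl) != 0 ->
  exists al be, forall x, x != 0 ->
    th (x * wk) * th (x * wl) =
      al * (th (x * zk) * th (x * (zl * Q))) + be * (th (x * zl) * th (x * (zk * Q))).
Proof.
move=> zk0 zl0 wk0 Q0 ww thQ thz.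
pose s := sqrtC (zk * zl * Q).
have s2 : s * s = zk * zl * Q by rewrite -expr2 sqrtCK.
have s0 : s != 0 by rewrite sqrtC_eq0 !mulf_neq0.
pose k := zk / s; pose l := zl / s; pose a := wk / s.
have k0 : k != 0 by rewrite mulf_neq0 ?invr_eq0.
have l0 : l != 0 by rewrite mulf_neq0 ?invr_eq0.
have a0 : a != 0 by rewrite mulf_neq0 ?invr_eq0.
have kl : thpm k l != 0.
  rewrite /thpm; have -> : k * l = Q^-1.
    apply: (mulfI Q0); rewrite divff // /k /l.
    have -> : Q * (zk / s * (zl / s)) = zk * zl * Q / (s * s) by field.
    by rewrite s2 divff // !mulf_neq0.
  have -> : k / l = zk / zl by rewrite /k /l; field; rewrite s0 zl0.
  by rewrite thV // mulf_neq0 // mulf_neq0 // oppr_eq0 invr_eq0.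
exists (thpm l a / thpm l k), (thpm k a / thpm k l) => x x0.
have xs : x * s != 0 by rewrite mulf_neq0.
have e1 w w' : w != 0 -> w * w' = s * s -> thpm (x * s) (w / s) = th (x * w) * th (x * w').
  move=> w0 e; rewrite /thpm; congr (th _ * th _); first by field.
  have -> : w' = s * s / w by rewrite -e; field.
  by field; rewrite s0 w0.
rewrite -(e1 wk wl) ?s2 // -(e1 zk (zl * Q)) //; last by rewrite s2; ring.
rewrite -(e1 zl (zk * Q)) //; last by rewrite s2; ring.
exact: thpm_expand.
Qed.


Section NodesInterp.
Variables (I : finType) (z : I -> K) (q : K).
Hypotheses (z_neq0 : forall i, z i != 0) (q_neq0 : q != 0).

(* Induction on the number of nodes: the three-term relation merges the factors
   of two nodes [k] and [l], producing one factor that vanishes at a node and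
   one factor for the remaining node. *)
Lemma interpA (S : {set I}) (y : I -> nat) (c : K) :
    c != 0 -> (0 < #|S|)%N ->
    (forall i, (0 < i <= \sum_(k in S) y k)%N -> th (q ^+ i) != 0) ->
    (forall j k, j \in S -> k \in S -> j != k -> th (z j / z k) != 0) ->
  th (q ^+ \sum_(k in S) y k) * \prod_(k in S) th (c * (z k * q ^+ y k)) =
  interp (fun j c => th (c * z j)) (fun m => (z m)^-1)
    (fun m c => th (c * (z m * q ^+ \sum_(k in S) y k))) S
    (fun c => \prod_(k in S) th (c * (z k * q ^+ y k))) c.
Proof.
move=> c0.
elim: {S}_.+1 {-2}S y (ltnSn #|S|) => // n IH S y; rewrite ltnS => Sn S0 hq hz.
case/card_gt0P: S0 => k kS.
have ekk j : th ((z j)^-1 * z j) = 0 by rewrite mulVf // th1.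
have ekm j : j \in S -> forall m, m \in S :\ j -> th ((z m)^-1 * z j) != 0.
  by move=> jS m; rewrite !inE => /andP[mj mS]; rewrite mulrC hz // eq_sym.
have cSk j : j \in S -> (#|S :\ j| < n)%N.
  by move=> jS; move: Sn; rewrite (cardsD1 j) jS.
case: (set_0Vmem (S :\ k)) => [Sk0 | [l lSk]].
  have -> : S = [set k] by rewrite -(finset.setD1K kS) Sk0 finset.setU0.
  rewrite /interp !big_set1 finset.setDv big_set0 mulr1 mulKf //.
have lS : l \in S by move: lSk; rewrite inE => /andP[].
have kl : k != l by move: lSk; rewrite !inE eq_sym => /andP[].
have kSl : k \in S :\ l by rewrite !inE kl.
have subz j : {subset S :\ j <= S} by move=> i; rewrite inE => /andP[].
have hzD j : forall i m, i \in S :\ j -> m \in S :\ j -> i != m -> th (z i / z m) != 0.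
  by move=> i m /subz iS /subz mS; apply: hz.
have IHj j (y' : I -> nat) : j \in S -> (0 < #|S :\ j|)%N ->
    (\sum_(i in S :\ j) y' i = \sum_(i in S) y i)%N ->
    interp (fun j c => th (c * z j)) (fun m => (z m)^-1)
      (fun m c => th (c * (z m * q ^+ \sum_(k in S) y k))) S
      (fun c => th (c * z j) * \prod_(i in S :\ j) th (c * (z i * q ^+ y' i))) c
    = th (q ^+ \sum_(k in S) y k) *
      (th (c * z j) * \prod_(i in S :\ j) th (c * (z i * q ^+ y' i))).
  move=> jS Sj0 sy.
  rewrite (@interp_mul _ _ _ _ _ _ j) ?ekk //; last exact: ekm.
  by rewrite -sy mulrCA; congr (_ * _); rewrite IH ?cSk ?sy //; apply: hzD.
have Sk0 : (0 < #|S :\ k|)%N by apply/card_gt0P; exists l.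
have Sl0 : (0 < #|S :\ l|)%N by apply/card_gt0P; exists k.
have sS : (\sum_(i in S) y i = y k + (y l + \sum_(i in S :\ k :\ l) y i))%N.
  by rewrite (big_setD1 k) //= (big_setD1 l).
have [yk0 | yk0] := eqVneq (y k) 0%N.
  have sy : (\sum_(i in S :\ k) y i = \sum_(i in S) y i)%N.
    by rewrite [RHS](big_setD1 k) //= yk0.
  rewrite (@interp_lin _ _ _ _ _ _ S _
    (fun c => th (c * z k) * \prod_(i in S :\ k) th (c * (z i * q ^+ y i)))
    (fun c => 0) c 1 0); last first.
    by move=> m mS; rewrite mul1r mul0r addr0 (big_setD1 k) //= yk0 expr0 mulr1.
  by rewrite mul1r mul0r addr0 IHj // [in LHS](big_setD1 k (F := fun i => th _)) //= yk0 expr0 mulr1.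
(* Merging moves the whole exponent [y k + y l] to one of the two nodes. The total is preserved, so
   the induction hypothesis applies with the same power of [q]. *)
pose Y i0 i := if i == i0 then (y k + y l)%N else y i.
have Ysum i0 i1 : i0 \in S -> i1 \in S :\ i0 -> (y i0 + y i1 = y k + y l)%N ->
    (\sum_(i in S :\ i0) Y i1 i = \sum_(i in S) y i)%N.
  move=> i0S i1S e; rewrite [RHS](big_setD1 i0) //= !(big_setD1 i1 i1S) /= addnA e.
  rewrite {1}/Y eqxx; congr addn; apply: eq_bigr => i; rewrite !inE /Y.
  by case: eqP.
have Yprod i0 i1 x : i1 \in S :\ i0 ->
    \prod_(i in S :\ i0) th (x * (z i * q ^+ Y i1 i)) =
    th (x * (z i1 * q ^+ (y k + y l))) *
      \prod_(i in S :\ i0 :\ i1) th (x * (z i * q ^+ y i)).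
  move=> i1S; rewrite (big_setD1 i1) //= {1}/Y eqxx; congr (_ * _).
  by apply: eq_bigr => i; rewrite !inE /Y; case: eqP.
have Skl : S :\ l :\ k = S :\ k :\ l by apply/setP => i; rewrite !inE andbCA.
have [||||||| al [be hab]] := @th_merge (z k) (z l) (z k * q ^+ y k) (z l * q ^+ y l)
    (q ^+ (y k + y l)); rewrite ?mulf_neq0 ?expf_neq0 //.
- by rewrite exprD; ring.
- by apply: hq; rewrite sS; lia.
- exact: hz.
have hF x : x != 0 -> \prod_(i in S) th (x * (z i * q ^+ y i)) =
    al * (th (x * z k) * \prod_(i in S :\ k) th (x * (z i * q ^+ Y l i)))
    + be * (th (x * z l) * \prod_(i in S :\ l) th (x * (z i * q ^+ Y k i))).
  move=> x0; rewrite (big_setD1 k) //= (big_setD1 l) //= mulrA hab // !Yprod // Skl.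
  by ring.
rewrite (@interp_lin _ _ _ _ _ _ S _
    (fun c => th (c * z k) * \prod_(i in S :\ k) th (c * (z i * q ^+ Y l i)))
    (fun c => th (c * z l) * \prod_(i in S :\ l) th (c * (z i * q ^+ Y k i))) c al be).
  rewrite !IHj ?Ysum // 1?addnC // hF //; ring.
by move=> m mS; apply: hF; rewrite invr_eq0.
Qed.

(* The analogue of Lagrange interpolation for even theta functions; again the
   three-term relation reduces the number of nodes. *)
Lemma interpC (S : {set I}) (s : seq K) (c : K) :
    c != 0 -> #|S| = (size s).+1 -> all (fun a => a != 0) s ->
    (forall j k, j \in S -> k \in S -> j != k -> thpm (z j) (z k) != 0) ->
  \prod_(a <- s) thpm c a =
  interp (fun j c => thpm c (z j)) z (fun _ _ => 1) S (fun c => \prod_(a <- s) thpm c a) c.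
Proof.
move=> c0; elim: s S => [|a s IH] S Ss.
  move=> _ _; have /cards1P[k ->] : #|S| == 1%N by rewrite Ss.
  by rewrite /interp big_set1 !big_nil finset.setDv big_set0 !mulr1.
move=> /= /andP[a0 s0] hz.
have /card_gt0P[k kS] : (0 < #|S|)%N by rewrite Ss.
have cSk j : j \in S -> #|S :\ j| = (size s).+1.
  by move=> jS; move: Ss; rewrite (cardsD1 j) jS /= add1n => -[].
have /card_gt0P[l lSk] : (0 < #|S :\ k|)%N by rewrite cSk.
have lS : l \in S by move: lSk; rewrite inE => /andP[].
have kl : k != l by move: lSk; rewrite !inE eq_sym => /andP[].
have ekk j : thpm (z j) (z j) = 0 by rewrite /thpm divff // th1 mulr0.
have ekm j : j \in S -> forall m, m \in S :\ j -> thpm (z m) (z j) != 0.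
  by move=> jS m; rewrite !inE => /andP[mj mS]; rewrite hz.
have IHj j : j \in S ->
    interp (fun j c => thpm c (z j)) z (fun _ _ => 1) S
      (fun c => thpm c (z j) * \prod_(a <- s) thpm c a) c =
    thpm c (z j) * \prod_(a <- s) thpm c a.
  move=> jS; rewrite (@interp_mul _ _ _ _ _ _ j) ?ekk //; last exact: ekm.
  rewrite -IH ?cSk // => i m; rewrite !inE => /andP[_ iS] /andP[_ mS].
  exact: hz.
have hF x : x != 0 -> \prod_(b <- a :: s) thpm x b =
    thpm (z l) a / thpm (z l) (z k) * (thpm x (z k) * \prod_(b <- s) thpm x b)
    + thpm (z k) a / thpm (z k) (z l) * (thpm x (z l) * \prod_(b <- s) thpm x b).
  move=> x0; rewrite big_cons (@thpm_expand a (z k) (z l)) ?hz //; ring.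
rewrite (@interp_lin _ _ _ _ _ _ S _
    (fun c => thpm c (z k) * \prod_(b <- s) thpm c b)
    (fun c => thpm c (z l) * \prod_(b <- s) thpm c b) c
    (thpm (z l) a / thpm (z l) (z k)) (thpm (z k) a / thpm (z k) (z l))).
  by rewrite !IHj // hF.
by move=> m mS; apply: hF.
Qed.
End NodesInterp.

(** * The cleared summation formula *)

Variable q : K.
Hypothesis q_neq0 : q != 0.

Definition poch x n := \prod_(i < n) th (x * q ^+ i).

Lemma pochS x n : poch x n.+1 = th x * poch (x * q) n.
Proof.
rewrite /poch big_ord_recl mulr1; congr (_ * _); apply: eq_bigr => i _.
by rewrite exprS mulrA.
Qed.

Lemma pochSr x n : poch x n.+1 = poch x n * th (x * q ^+ n).
Proof. by rewrite /poch big_ord_recr. Qed.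

Lemma poch_neq0 x n : (forall i, (i < n)%N -> th (x * q ^+ i) != 0) -> poch x n != 0.
Proof. by move=> h; apply/prodf_neq0 => i _; apply: h. Qed.

Lemma poch_cat x m n : poch x (m + n) = poch x m * poch (x * q ^+ m) n.
Proof.
elim: m x => [|m IH] x; first by rewrite add0n expr0 mulr1 /poch big_ord0 mul1r.
by rewrite addSn !pochS IH exprS !mulrA.
Qed.

(** The arguments on the left are the inverses of those on the right in reverse order; inverting
    [x * q ^+ i] costs a factor [- x * q ^+ i]. *)
Lemma poch_reflect x n : x != 0 ->
  poch (x^-1 * q ^ (1 - n%:Z)) n * ((- x) ^+ n * q ^+ 'C(n, 2)) = poch x n.
Proof.
move=> x0; elim: n => [|n IH]; first by rewrite /poch !big_ord0 !mul1r.
have xq0 : x * q ^+ n != 0 by rewrite mulf_neq0 ?expf_neq0.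
have e1 : x^-1 * q ^ (1 - n.+1%:Z) = (x * q ^+ n)^-1.
  have -> : 1 - n.+1%:Z = - n%:Z by lia.
  by rewrite invfM -exprnN.
rewrite [RHS]pochSr -IH pochS {1}e1 thV // binS bin1 exprD exprS.
have -> : x^-1 * q ^ (1 - n.+1%:Z) * q = x^-1 * q ^ (1 - n%:Z).
  have -> : 1 - n%:Z = (1 - n.+1%:Z) + 1 by lia.
  by rewrite [in RHS]expfzDr // expr1z mulrA.
by field; rewrite x0 expf_neq0.
Qed.

(* The factors of the summand that involve both [z_j = u] and [z_k = v]; unlike the
   Vandermonde factor alone, their product is symmetric ([pairwC]). *)
Definition pairw u v a b :=
  (q ^+ a * th (v * q ^+ b / (u * q ^+ a))) /
  (th (v / u) * poch (u * v) (a + b) * (poch (q * v / u) b * poch (q * u / v) a)).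

Lemma pairwC u v a b : u != 0 -> v != 0 -> pairw u v a b = pairw v u b a.
Proof.
move=> u0 v0; rewrite /pairw -[v * _ / _]invf_div thV; last first.
  by rewrite !(mulf_neq0, invr_eq0, expf_neq0).
rewrite -[v / u]invf_div thV ?mulf_neq0 ?invr_eq0 //.
rewrite addnC (mulrC u v) [poch _ b * _]mulrC.
rewrite !invfM !invrK !invrN.
have qa0 : q ^+ a != 0 by rewrite expf_neq0.
have qb0 : q ^+ b != 0 by rewrite expf_neq0.
set X := th _; set Y := (th _)^-1; set Z := (poch _ _)^-1.
set T := (poch _ _)^-1; set U := (poch _ _)^-1.
by field; rewrite u0 v0 qa0.
Qed.

(** The extra theta factor exchanges [poch (q * v / u) b] for [poch (v / u) b], the symbol that
    belongs to [u * q], while [u * q ^+ a.+1] and [u * q * q ^+ a] are the same point. *)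
Lemma pairw_shift N u v a b : u != 0 -> v != 0 -> (a + b < N)%N ->
    (forall i, (i < N)%N -> th (u * v * q ^+ i) != 0) ->
    (forall i, (i <= N)%N -> th (u / v * q ^+ i) != 0) ->
    (forall i, (i <= N)%N -> th (v / u * q ^+ i) != 0) ->
  pairw u v a.+1 b * th (u^-1 * (v * q ^+ b)) =
  - (v / u) / th (u * v) * pairw (u * q) v a b.
Proof.
move=> u0 v0 abN huv hu hv; rewrite /pairw.
have e : poch (v / u) b * th (u^-1 * (v * q ^+ b)) = th (v / u) * poch (q * v / u) b.
  by rewrite [u^-1 * _]mulrCA mulrA -pochSr pochS; congr (_ * poch _ _); ring.
have th0 : th (v / u) != 0 by rewrite -[v / u]mulr1 -(expr0 q) hv.
have thq : th (q * u / v) != 0.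
  by have := hu 1%N; rewrite expr1 mulrC mulrA => -> //; lia.
have P1 : poch (v / u) b != 0 by apply: poch_neq0 => i ib; apply: hv; lia.
have P2 : poch (q * v / u) b != 0.
  apply: poch_neq0 => i ib; have -> : q * v / u * q ^+ i = v / u * q ^+ i.+1.
    by rewrite !exprS; ring.
  by apply: hv; lia.
have P3 : poch (q * (u * q) / v) a != 0.
  apply: poch_neq0 => i ib; have -> : q * (u * q) / v * q ^+ i = u / v * q ^+ i.+2.
    by rewrite !exprS; ring.
  by apply: hu; lia.
have P4 : poch (u * q * v) (a + b) != 0.
  apply: poch_neq0 => i ib; have -> : u * q * v * q ^+ i = u * v * q ^+ i.+1.
    by rewrite !exprS; ring.
  by apply: huv; lia.
have thuv : th (u * v) != 0 by rewrite -[u * v]mulr1 -(expr0 q) huv //; lia.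
rewrite addSn !pochS.
have -> : u * v * q = u * q * v by ring.
have -> : q * u / v * q = q * (u * q) / v by ring.
have -> : q * v / (u * q) = v / u by field; rewrite u0.
have -> : u * q ^+ a.+1 = u * q * q ^+ a by rewrite exprS; ring.
have -> : th (v / (u * q)) = - (v / (u * q)) * th (q * u / v).
  have -> : v / (u * q) = (q * u / v)^-1 by field; rewrite u0 q_neq0 v0.
  by rewrite thV // !(mulf_neq0, invr_eq0).
set X := th (_ * _ / (_ * _ * _)).
have -> : th (u^-1 * (v * q ^+ b)) = th (v / u) * poch (q * v / u) b / poch (v / u) b.
  by rewrite -e; field.
rewrite exprS.
have qa0 : q ^+ a != 0 by rewrite expf_neq0.
by field; rewrite u0 v0 q_neq0 th0 thq P1 P2 P3 P4 thuv.
Qed.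

(** Symmetry lets [m] stand first in each of its pairs, so a shift at [m] needs no distinction by
    the order of the indices. *)
Lemma big_pairs n (F : 'I_n -> 'I_n -> K) m : (forall j k, F j k = F k j) ->
  \prod_(j < n) \prod_(k < n | (j < k)%N) F j k =
  (\prod_(k < n | k != m) F m k) *
  \prod_(j < n | j != m) \prod_(k < n | (j < k)%N && (k != m)) F j k.
Proof.
move=> FC; rewrite (bigD1 m) //= [X in _ = X * _](bigID (fun k : 'I_n => (m < k)%N)) /=.
rewrite -mulrA; congr (_ * _).
  by apply: eq_bigl => k; rewrite -val_eqE /=; lia.
have -> : \prod_(k < n | (k != m) && ~~ (m < k)%N) F m k =
    \prod_(j < n | j != m) (if (j < m)%N then F j m else 1).
  rewrite -big_mkcondr /=; apply: eq_big => k; first by rewrite -val_eqE /=; lia.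
  by move=> _; apply: FC.
rewrite -big_split; apply: eq_bigr => j jm /=.
case: ifP => jltm; first by rewrite (bigD1 m).
rewrite mul1r; apply: eq_bigl => k; case: (eqVneq k m) => [->|_].
  by rewrite jltm.
by rewrite andbT.
Qed.

(** Distributes the denominators $(qz_k/z_j)_{y_k}$: the diagonal ones go to [singlew], the others
    to [pairw]. *)
Lemma big_offdiag n (F : 'I_n -> 'I_n -> K) :
  \prod_(j < n) \prod_(k < n) F j k =
  (\prod_(k < n) F k k) * \prod_(j < n) \prod_(k < n | (j < k)%N) (F j k * F k j).
Proof.
rewrite [X in _ = _ * X](eq_bigr (fun j : 'I_n => (\prod_(k < n | (j < k)%N) F j k) *
    \prod_(k < n | (j < k)%N) F k j)); last by move=> j _; rewrite big_split.
rewrite big_split /= [X in _ = _ * (_ * X)](exchange_big_dep xpredT) //= mulrCA -!big_split.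
apply: eq_bigr => j _ /=; rewrite (bigD1 j) //= mulrCA; congr (_ * _).
rewrite (bigID (fun k : 'I_n => (j < k)%N)) /=; congr (_ * _).
  by apply: eq_bigl => k; rewrite -val_eqE /=; lia.
by apply: eq_bigl => k; rewrite -val_eqE /=; lia.
Qed.

(** * The induction on [N] *)

Section Multisum.
Variables (n : nat) (s : seq K).
Implicit Types (z : 'I_n -> K) (y : 'I_n -> nat) (m : 'I_n).

Definition singlew u a := (\prod_(x <- s) (poch (u * x) a * poch (u / x) a)) / poch q a.

Definition coefD y z :=
  (\prod_(j < n) \prod_(k < n | (j < k)%N) pairw (z j) (z k) (y j) (y k)) *
  \prod_(k < n) singlew (z k) (y k).

(* The factors involving [b], relative to [prod_k (b z_k, b / z_k)_N]. *)
Definition coefW N b y z :=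
  \prod_(k < n) (poch (b * (z k * q ^+ y k)) (N - y k) * poch (b / z k) (N - y k)).

Lemma eq_coefD y y' z : y =1 y' -> coefD y z = coefD y' z.
Proof.
move=> e; congr (_ * _); last by apply: eq_bigr => k _; rewrite e.
by apply: eq_bigr => j _; apply: eq_bigr => k _; rewrite !e.
Qed.

Lemma eq_coefW N b y y' z : y =1 y' -> coefW N b y z = coefW N b y' z.
Proof. by move=> e; apply: eq_bigr => k _; rewrite e. Qed.

(** When [y m] is positive, the two shifts together fix all points [z k * q ^+ y k]. *)
Definition shiftz m z k := if k == m then z k * q else z k.
Definition shifty m y k := if k == m then (y k).-1 else y k.

(** These conditions cover the denominators free of [b]. Exponent 0 in the last one accounts for the
    Vandermonde determinant and for the interpolation nodes. *)
Definition generic N z :=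
  [/\ forall k, z k != 0,
      forall i, (0 < i <= N)%N -> th (q ^+ i) != 0,
      forall j k, j != k -> forall i, (i < N)%N -> th (z j * z k * q ^+ i) != 0
    & forall j k, j != k -> forall i, (i <= N)%N -> th (z j / z k * q ^+ i) != 0].

Lemma generic_shift N z m : generic N.+1 z -> generic N (shiftz m z).
Proof.
move=> [z0 hq hs hd]; split.
- by move=> k; rewrite /shiftz; case: ifP => // _; rewrite mulf_neq0.
- by move=> i iN; apply: hq; lia.
- move=> j k jk i iN; rewrite /shiftz.
  case: (eqVneq j m) jk => [->|jm]; case: (eqVneq k m) => [->|km] // jk.
  + have -> : z m * q * z k * q ^+ i = z m * z k * q ^+ i.+1 by rewrite exprS; ring.
    by apply: hs; rewrite // eq_sym.
  + have -> : z j * (z m * q) * q ^+ i = z j * z m * q ^+ i.+1 by rewrite exprS; ring.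
    by apply: hs.
  by apply: hs => //; lia.
- move=> j k jk i iN; rewrite /shiftz.
  case: (eqVneq j m) jk => [->|jm]; case: (eqVneq k m) => [->|km] // jk.
  + have -> : z m * q / z k * q ^+ i = z m / z k * q ^+ i.+1 by rewrite exprS; ring.
    by apply: hd; rewrite // eq_sym.
  (* At [i = 0] the exponent of [q] is -1, outside the range of [hd]; inversion turns it into the
     ratio [z m / z j] with exponent 1. *)
  + case: i iN => [|i] iN.
      have -> : z j / (z m * q) * q ^+ 0 = (z m / z j * q ^+ 1)^-1.
        by rewrite expr1 mulr1; field; rewrite !z0 q_neq0.
      have zq0 : z m / z j * q ^+ 1 != 0.
        by rewrite !(mulf_neq0, invr_eq0, expf_neq0).
      by rewrite thV // mulf_neq0 ?oppr_eq0 ?invr_eq0 // hd // eq_sym.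
    have -> : z j / (z m * q) * q ^+ i.+1 = z j / z m * q ^+ i.
      by rewrite exprS; field; rewrite !z0 q_neq0.
    by apply: hd => //; lia.
  by apply: hd => //; lia.
Qed.

(** Pairs without [m] agree on both sides, and pairs with [m] are handled by [pairw_shift]. At [m]
    itself the factor [th (q ^+ y m)] removes the last factor of [poch q (y m)], while the symbols
    in the numerator give up their first factors as [thpm (z m) x]. *)
Lemma coefD_shift N y z m : generic N z -> (\sum_k y k = N)%N -> (0 < y m)%N ->
  coefD y z * \prod_k th ((z m)^-1 * (z k * q ^+ y k)) =
  \prod_(x <- s) thpm (z m) x *
  \prod_(k | k != m) (- (z k / z m) / th (z m * z k)) *
  coefD (shifty m y) (shiftz m z).
Proof.
move=> [z0 hq hs hd] yN ym; rewrite /coefD.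
rewrite !(@big_pairs n _ m);
  try by move=> j k; apply: pairwC => //; rewrite /shiftz; case: ifP; rewrite ?mulf_neq0.
set P := \prod_(j < n | j != m) \prod_(k < n | _) pairw (z j) _ _ _.
set P' := \prod_(j < n | j != m) \prod_(k < n | _) _.
have <- : P = P'.
  apply: eq_bigr => j jm; apply: eq_bigr => k /andP[_ km].
  by rewrite /shiftz /shifty (negbTE jm) (negbTE km).
rewrite (bigD1 m (F := fun k => singlew _ _)) //=.
rewrite (bigD1 m (F := fun k => singlew (shiftz _ _ _) _)) //=.
rewrite (bigD1 m (F := fun k => th _)) //=.
have -> : \prod_(i < n | i != m) singlew (shiftz m z i) (shifty m y i) =
    \prod_(i < n | i != m) singlew (z i) (y i).
  by apply: eq_bigr => k km; rewrite /shiftz /shifty (negbTE km).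
set Q := \prod_(i < n | i != m) singlew _ _.
have hB : (\prod_(k < n | k != m) pairw (z m) (z k) (y m) (y k)) *
    \prod_(k < n | k != m) th ((z m)^-1 * (z k * q ^+ y k)) =
    \prod_(k | k != m) (- (z k / z m) / th (z m * z k)) *
    \prod_(k < n | k != m) pairw (shiftz m z m) (shiftz m z k) (shifty m y m) (shifty m y k).
  rewrite -!big_split; apply: eq_bigr => k km /=.
  rewrite /shiftz /shifty eqxx (negbTE km) -{1}(prednK ym).
  apply: (@pairw_shift N) => //; last 3 first.
  - by apply: hs; rewrite eq_sym.
  - by apply: hd; rewrite eq_sym.
  - by apply: hd.
  by move: yN; rewrite (bigD1 m) //= (bigD1 k) //=; lia.
have hA : singlew (z m) (y m) * th ((z m)^-1 * (z m * q ^+ y m)) =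
    \prod_(x <- s) thpm (z m) x * singlew (shiftz m z m) (shifty m y m).
  have : (y m <= N)%N by rewrite -yN (bigD1 m) //=; lia.
  rewrite /shiftz /shifty eqxx mulKf // /singlew; case: (y m) ym => // c _ cN /=.
  have -> : \prod_(x <- s) (poch (z m * x) c.+1 * poch (z m / x) c.+1) =
      \prod_(x <- s) thpm (z m) x *
      \prod_(x <- s) (poch (z m * q * x) c * poch (z m * q / x) c).
    rewrite -big_split; apply: eq_bigr => x _ /=; rewrite !pochS /thpm.
    by rewrite (mulrAC _ x q) (mulrAC _ x^-1 q); ring.
  have h1 : th (q ^+ c.+1) != 0 by apply: hq.
  have h2 : poch q c != 0.
    by apply: poch_neq0 => i iy; rewrite -exprS; apply: hq; lia.
  by rewrite pochSr -exprS; field; rewrite h1 h2.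
rewrite [LHS](_ : _ = P * Q * ((\prod_(k < n | k != m) pairw (z m) (z k) (y m) (y k)) *
    \prod_(k < n | k != m) th ((z m)^-1 * (z k * q ^+ y k))) *
    (singlew (z m) (y m) * th ((z m)^-1 * (z m * q ^+ y m)))); last by ring.
by rewrite hB hA; ring.
Qed.

Lemma th_nodes N z j k : generic N z -> j != k -> th (z j / z k) != 0.
Proof. by case=> _ _ _ hd jk; have := hd _ _ jk 0%N; rewrite expr0 mulr1; apply. Qed.

Lemma thpm_nodes N z j k : generic N.+1 z -> j != k -> thpm (z j) (z k) != 0.
Proof.
move=> gz jk; rewrite /thpm mulf_neq0 ?(th_nodes gz) //.
by case: gz => _ _ hs _; have := hs _ _ jk 0%N; rewrite expr0 mulr1; apply.
Qed.

Lemma interpA_ord N b y z : generic N.+1 z -> (\sum_k y k = N.+1)%N -> b != 0 ->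
  th (q ^+ N.+1) * \prod_k th (b * (z k * q ^+ y k)) =
  \sum_m \prod_k th ((z m)^-1 * (z k * q ^+ y k)) * th (b * (z m * q ^+ N.+1)) *
    \prod_(k | k != m) (th (b * z k) / th ((z m)^-1 * z k)).
Proof.
move=> gz yN b0; have [z0 hq _ _] := gz.
have setTE (F : 'I_n -> K) : \prod_(k in [set: 'I_n]) F k = \prod_k F k.
  by apply: eq_bigl => k; rewrite finset.in_setT.
have sumT : (\sum_(k in [set: 'I_n]) y k = N.+1)%N.
  by rewrite -yN; apply: eq_bigl => k; rewrite finset.in_setT.
have n0 : (0 < #|[set: 'I_n]|)%N.
  rewrite cardsT card_ord; case: (posnP n) => // n0; move: yN.
  by rewrite big1 // => i; have := ltn_ord i; rewrite [in X in (_ < X)%N]n0.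
have := @interpA _ z q z0 q_neq0 [set: 'I_n] y b b0 n0.
rewrite sumT setTE => -> //; last by move=> j k _ _; apply: th_nodes gz.
rewrite /interp; apply: eq_big => [m | m _]; rewrite ?finset.in_setT // setTE; congr (_ * _).
by apply: eq_bigl => k; rewrite !inE andbT.
Qed.

(** The Lagrange term of the node [z m] in type C interpolation at [b]. *)
Definition stepw b z m :=
  \prod_(x <- s) thpm (z m) x * \prod_(k | k != m) (thpm b (z k) / thpm (z m) (z k)).

Lemma sum_stepw N b z : n = (size s).+1 -> all (fun x => x != 0) s -> generic N.+1 z -> b != 0 ->
  \sum_m stepw b z m = \prod_(x <- s) thpm b x.
Proof.
move=> ns s0 gz b0; have [z0 _ _ _] := gz.
rewrite (@interpC _ z z0 [set: 'I_n]) //; last 2 first.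
- by rewrite cardsT card_ord.
- by move=> j k _ _; apply: thpm_nodes gz.
rewrite /interp; apply: eq_big => [m | m _]; first by rewrite finset.in_setT.
by rewrite mulr1; congr (_ * _); apply: eq_bigl => k; rewrite !inE andbT.
Qed.

(* If some [y m = N.+1], only the term of index [m] survives; otherwise all
   [y k <= N], and [coefW] contains the factor [prod_k th (b z_k q^(y_k))] to which
   [interpA_ord] applies. No division by that factor is needed. *)
Lemma coef_step N b y z : generic N.+1 z -> (\sum_k y k = N.+1)%N -> b != 0 ->
  th (q ^+ N.+1) * (coefD y z * coefW N.+1 b y z) =
  \sum_(m | (0 < y m)%N) stepw b z m *
    (coefD (shifty m y) (shiftz m z) * coefW N (b * q) (shifty m y) (shiftz m z)).
Proof.
move=> gz yN b0; have [z0 hq hs hd] := gz.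
(* Inverting [z k / z m] separates the factor left by the shift into two parts: the first cancels
   the denominators of type A interpolation, the second supplies those of type C. *)
have hR m : \prod_(k | k != m) (- (z k / z m) / th (z m * z k)) =
    \prod_(k | k != m) th ((z m)^-1 * z k) * \prod_(k | k != m) (thpm (z m) (z k))^-1.
  rewrite -big_split; apply: eq_bigr => k km /=.
  have := thpm_nodes gz km; rewrite thpmC // mulf_eq0 negb_or => /andP[_].
  rewrite /thpm mulf_eq0 negb_or => /andP[h1 h2].
  have -> : (z m)^-1 * z k = (z m / z k)^-1 by rewrite invf_div mulrC.
  rewrite thV ?mulf_neq0 ?invr_eq0 //.
  by field; rewrite h1 h2 !z0.
have T0 m : \prod_(k | k != m) th ((z m)^-1 * z k) != 0.
  by apply/prodf_neq0 => k km; rewrite mulrC (th_nodes gz).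
have [/existsP[m /eqP ym]|/existsPn ylt] := boolP [exists m, y m == N.+1].
  have y0 k : k != m -> y k = 0%N.
    by move=> km; move: yN; rewrite (bigD1 m) //= (bigD1 k) //= ym; lia.
  rewrite (big_pred1 m) => [|k]; last first.
    by rewrite /=; case: (eqVneq k m) => [->|km]; [rewrite ym | rewrite y0].
  have ym0 : (0 < y m)%N by rewrite ym.
  have := coefD_shift gz yN ym0; rewrite hR (bigD1 m (F := fun k => th _)) //= mulKf // ym.
  rewrite (eq_bigr (fun k => th ((z m)^-1 * z k))); last first.
    by move=> k km; rewrite y0 // mulr1.
  set T := \prod_(k | k != m) th ((z m)^-1 * z k).
  have hW : coefW N.+1 b y z = \prod_(k | k != m) thpm b (z k) *
      coefW N (b * q) (shifty m y) (shiftz m z).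
    rewrite /coefW [LHS](bigD1 m) //= [X in _ = _ * X](bigD1 m) //=.
    rewrite /shifty eqxx ym !subnn /poch !big_ord0 !mul1r.
    rewrite -big_split; apply: eq_bigr => k km /=.
    rewrite /shiftz (negbTE km) y0 // !subn0 -/(poch _ _) -/(poch _ _) !pochS mulr1 /thpm /poch.
    by rewrite (mulrAC _ (z k) q) (mulrAC _ _^-1 q); ring.
  rewrite hW /stepw [\prod_(k < n | k != m) (thpm b _ / _)]big_split /=.
  set W := coefW _ _ _ _; set D' := coefD (shifty _ _) _; set D := coefD _ _.
  set X := \prod_(_ <- _) _; set Y := \prod_(k < n | _) thpm b _.
  set Z := \prod_(k < n | _) (thpm _ _)^-1 => e.
  apply: (mulIf (T0 m)); rewrite -/T.
  transitivity (D * (th (q ^+ N.+1) * T) * Y * W); first by ring.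
  by rewrite e; ring.
have yle k : (y k <= N)%N.
  have := ylt k; have : (y k <= N.+1)%N by rewrite -yN (bigD1 k) //= leq_addr.
  by move=> h1 h2; lia.
(* [V] is common to [coefW] before and after the shift. The unshifted side retains the product to be
   interpolated; the shifted side has one more factor [th (b * (z m * q ^+ N.+1))], which is exactly
   the extra factor of type A interpolation. *)
pose V := \prod_k (poch (b * (z k * q ^+ y k) * q) (N - y k) * poch (b / z k * q) (N - y k)).
have hW : coefW N.+1 b y z = \prod_k th (b * (z k * q ^+ y k)) * \prod_k th (b / z k) * V.
  rewrite /coefW -!big_split; apply: eq_bigr => k _ /=.
  by rewrite subSn // !pochS; ring.
have hW' m : (0 < y m)%N -> coefW N (b * q) (shifty m y) (shiftz m z) =
    V * th (b / z m) * th (b * (z m * q ^+ N.+1)).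
  move=> ym; rewrite /coefW /V (bigD1 m) //= [X in _ = X * _ * _](bigD1 m) //= /shifty /shiftz eqxx.
  rewrite [X in _ * X = _](eq_bigr (fun k => poch (b * (z k * q ^+ y k) * q) (N - y k) *
     poch (b / z k * q) (N - y k))); last first.
    by move=> k km; rewrite (negbTE km) (mulrAC b _ q) (mulrAC b _ q).
  have -> : (N - (y m).-1 = (N - y m).+1)%N by have := yle m; lia.
  rewrite [X in X * _ * _ = _]pochSr [X in _ * X * _ = _]pochS.
  have -> : b * q * (z m * q * q ^+ (y m).-1) = b * (z m * q ^+ y m) * q.
    by rewrite -{2}(prednK ym) exprS; ring.
  have -> : b * (z m * q ^+ y m) * q * q ^+ (N - y m) = b * (z m * q ^+ N.+1).
    by rewrite -{2}(subnKC (yle m)) exprS exprD; ring.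
  have -> : b * q / (z m * q) = b / z m by field; rewrite q_neq0 z0.
  by ring.
transitivity (coefD y z * \prod_k th (b / z k) * V *
    (th (q ^+ N.+1) * \prod_k th (b * (z k * q ^+ y k)))).
  by rewrite hW; ring.
rewrite (interpA_ord gz yN b0) mulr_sumr [RHS]big_mkcond /=; apply: eq_bigr => m _.
case: ifP => ym; last first.
  have ym0 : y m = 0%N by move: ym; case: (y m).
  have -> : \prod_k th ((z m)^-1 * (z k * q ^+ y k)) = 0.
    by rewrite (bigD1 m) //= ym0 mulr1 mulVf // th1 mul0r.
  by rewrite !(mul0r, mulr0).
have := coefD_shift gz yN ym; rewrite hR hW' // /stepw.
rewrite (bigD1 m (F := fun k => th (b / z k))) //=.
set f := \prod_k th _; set D := coefD y z; set D' := coefD _ _ => e.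
transitivity (D * f * (th (b / z m) * \prod_(k | k != m) th (b / z k)) * V *
   th (b * (z m * q ^+ N.+1)) * \prod_(k | k != m) (th (b * z k) / th ((z m)^-1 * z k))); first by ring.
rewrite e /thpm !big_split /= !prodfV.
set T := \prod_(k | k != m) th (_^-1 * _).
have T0' : T != 0 by apply: T0.
field; rewrite T0' andbT; apply/prodf_neq0 => k km.
by apply: thpm_nodes gz _; rewrite eq_sym.
Qed.

(** The bound [B] is separate from [N] so that the type of the summation index stays fixed during
    the induction. *)
Lemma multisum B N b z : (N <= B)%N -> n = (size s).+1 -> all (fun x => x != 0) s ->
    generic N z -> b != 0 ->
  \sum_(y : {ffun 'I_n -> 'I_B.+1} | (\sum_k y k)%N == N)
    coefD (fun k => y k) z * coefW N b (fun k => y k) z =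
  (\prod_(x <- s) (poch (b * x) N * poch (b / x) N)) / poch q N.
Proof.
move=> NB ns s0; elim: N NB b z => [|N IH] NB b z gz b0.
  rewrite (big_pred1 [ffun => ord0]) => [|y].
    rewrite /poch big_ord0 [X in _ = X / _]big1; last by move=> x _; rewrite !big_ord0 mulr1.
    rewrite divr1 /coefW [X in _ * X]big1 ?mulr1; last first.
      by move=> k _; rewrite /poch sub0n !big_ord0 mulr1.
    rewrite /coefD !big1 ?mulr1 //.
      move=> k _; rewrite /singlew ffunE /poch !big_ord0 big1 ?divr1 //.
      by move=> x _; rewrite !big_ord0 mulr1.
    move=> j _; rewrite big1 // => k jk; rewrite /pairw !ffunE /poch !big_ord0 /=.
    rewrite expr0 !mulr1 mul1r divff // (th_nodes gz) //.
    by rewrite -val_eqE /= gtn_eqF.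
  apply/idP/eqP => [/eqP e|-> ]; last by rewrite big1 // => k _; rewrite ffunE.
  apply/ffunP => k; rewrite ffunE; apply/val_inj => /=.
  by move: e; rewrite (bigD1 k) //= => /eqP; rewrite addn_eq0 => /andP[/eqP].
have thN : th (q ^+ N.+1) != 0 by case: gz => _ hq _ _; apply: hq; rewrite /= leqnn.
apply: (mulfI thN); rewrite mulr_sumr.
rewrite (eq_bigr (fun y : {ffun 'I_n -> 'I_B.+1} => \sum_(m | (0 < y m)%N) stepw b z m *
    (coefD (shifty m (fun k => y k)) (shiftz m z) *
     coefW N (b * q) (shifty m (fun k => y k)) (shiftz m z)))); last first.
  by move=> y /eqP yN; rewrite (coef_step gz).
rewrite (exchange_big_dep xpredT) //=.
transitivity (\sum_m stepw b z m *
   ((\prod_(x <- s) (poch (b * q * x) N * poch (b * q / x) N)) / poch q N)); last first.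
  rewrite -mulr_suml (sum_stepw ns s0 gz b0) pochSr -exprS.
  have pN : poch q N != 0.
    by apply: poch_neq0 => i iN; rewrite -exprS; case: gz => _ hq _ _; apply: hq; lia.
  rewrite mulrA -big_split /= (eq_bigr (fun x => poch (b * x) N.+1 * poch (b / x) N.+1)).
    by field; rewrite pN thN.
  by move=> x _; rewrite !pochS /thpm (mulrAC b q x) (mulrAC b q x^-1); ring.
apply: eq_bigr => m _; rewrite -mulr_sumr; congr (_ * _).
rewrite -(IH _ (b * q) (shiftz m z)) ?mulf_neq0 //; [|exact: ltnW|exact: generic_shift].
(* Raising and lowering the coordinate [m]. [inord] does not overflow in [h] when the coordinates
   sum to at most [N], as [N < B]. *)
pose h (y : {ffun 'I_n -> 'I_B.+1}) : {ffun 'I_n -> 'I_B.+1} :=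
  [ffun k => if k == m then inord (y k).+1 else y k].
pose h' (y : {ffun 'I_n -> 'I_B.+1}) : {ffun 'I_n -> 'I_B.+1} :=
  [ffun k => if k == m then inord (y k).-1 else y k].
have hm (w : {ffun 'I_n -> 'I_B.+1}) k : (\sum_k w k <= N)%N ->
    h w k = (if k == m then (w k).+1 else w k) :> nat.
  move=> yN; rewrite ffunE; case: eqP => // ->; rewrite inordK //.
  by move: yN; rewrite (bigD1 m) //=; lia.
have h'm (w : {ffun 'I_n -> 'I_B.+1}) k : h' w k = shifty m (fun k => w k) k :> nat.
  rewrite ffunE /shifty; case: eqP => // ->; rewrite inordK //.
  by have := ltn_ord (w m); lia.
rewrite (reindex_onto h h'); last first.
  move=> y /andP[_ ym]; apply/ffunP => k; rewrite ffunE; case: eqP => [->|km].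
    apply/val_inj; rewrite /= inordK h'm /shifty eqxx prednK //.
  by apply/val_inj; rewrite /= h'm /shifty; case: eqP km.
have hsum (w : {ffun 'I_n -> 'I_B.+1}) : (\sum_k w k = N)%N -> (\sum_k h w k = N.+1)%N.
  move=> yN; have e := yN; rewrite (bigD1 m) //= in e.
  rewrite (bigD1 m) //= hm ?yN // eqxx addSn -[in RHS]e; congr (_ + _).+1; apply: eq_bigr => k km.
  by rewrite hm ?yN // (negbTE km).
have hh' (w : {ffun 'I_n -> 'I_B.+1}) : (\sum_k w k = N)%N ->
    forall k, shifty m (fun k => h w k) k = w k.
  by move=> yN k; rewrite /shifty hm ?yN //; case: eqP.
apply: eq_big => [y | y /andP[/andP[/eqP hy hym] /eqP hhy]].
  apply/andP/eqP => [[/andP[/eqP hy hym] /eqP hhy]|yN].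
    have : (\sum_k shifty m (fun k => h y k) k).+1 = N.+1.
      rewrite -hy [in RHS](bigD1 m) //= (bigD1 m) //= {1}/shifty eqxx -addSn prednK //.
      by congr addn; apply: eq_bigr => k km; rewrite /shifty (negbTE km).
    by case=> <-; apply: eq_bigr => k _; rewrite -h'm hhy.
  rewrite hsum // hm ?yN // !eqxx; split=> //; apply/eqP/ffunP => k.
  by apply/val_inj; rewrite /= h'm hh'.
have e : shifty m (fun k => h y k) =1 (fun k => y k).
  by move=> k; rewrite -h'm hhy.
by rewrite (eq_coefD _ e) (eq_coefW _ _ _ e).
Qed.

(* The factors involving [b] are reflected so as to appear in the numerator. *)
Lemma term_coef N b y z : (forall k, z k != 0) -> b != 0 -> (\sum_k y k = N)%N ->
    (forall k, poch (b * z k) N != 0) -> (forall k, poch (b / z k) N != 0) ->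
  (\prod_(j < n) \prod_(k < n | (j < k)%N)
      (z j * q ^+ y j * th (z k * q ^+ y k / (z j * q ^+ y j)))) /
    (\prod_(j < n) \prod_(k < n | (j < k)%N) (z j * th (z k / z j))) *
    (\prod_(j < n) \prod_(k < n | (j < k)%N) (1 / poch (z j * z k) (y j + y k))) *
    \prod_(k < n)
      (q ^+ 'C(y k, 2) * z k ^+ y k
       * (\prod_(x <- s) (poch (z k * x) (y k) * poch (z k / x) (y k)))
       / (poch (b * z k) (y k) * poch (q ^ (1 - N%:Z) * z k / b) (y k)
          * \prod_(j < n) poch (q * z k / z j) (y k))) =
  (- (q ^ (N%:Z - 1) * b)) ^+ N / \prod_(k < n) (poch (b * z k) N * poch (b / z k) N) *
  (coefD y z * coefW N b y z).
Proof.
move=> z0 b0 yN pb pb'; set V := (X in X * _ = _).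
have e1 : V * \prod_(k < n) (\prod_(j < n) poch (q * z k / z j) (y k))^-1 =
   (\prod_(j < n) \prod_(k < n | (j < k)%N) pairw (z j) (z k) (y j) (y k)) *
   \prod_(k < n) (poch q (y k))^-1.
  rewrite prodfV big_offdiag invfM -prodfV mulrCA [RHS]mulrC.
  congr (_ * _); first by apply: eq_bigr => k _; rewrite mulfK.
  rewrite /V -!prodfV -!big_split; apply: eq_bigr => j _ /=; rewrite -!prodfV -!big_split.
  apply: eq_bigr => k _ /=; rewrite /pairw !invfM div1r.
  set T := th _; set T' := (th _)^-1; set P1 := (poch _ _)^-1; set P2 := (poch _ _)^-1.
  set P3 := (poch _ _)^-1.
  by rewrite [P2 * P3]mulrC; field; rewrite z0.
have yle k : (y k <= N)%N by rewrite -yN (bigD1 k) //= leq_addr.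
have e2 : \prod_k (q ^+ 'C(y k, 2) * z k ^+ y k /
      (poch (b * z k) (y k) * poch (q ^ (1 - N%:Z) * z k / b) (y k))) =
    (- (q ^ (N%:Z - 1) * b)) ^+ N / \prod_(k < n) (poch (b * z k) N * poch (b / z k) N) *
    coefW N b y z.
  have -> : (- (q ^ (N%:Z - 1) * b)) ^+ N = \prod_k (- (q ^ (N%:Z - 1) * b)) ^+ y k.
    by rewrite -expr_sum yN.
  rewrite -prodfV -!big_split; apply: eq_bigr => k _ /=.
  have ykN := yle k; have pk := pb k; have pk' := pb' k.
  have zk := z0 k; move: (y k) (z k) zk ykN pk pk' => c u u0 cN pk pk'.
  (* The argument at which the last [c] factors of [poch (b / u) N] begin; their reflection is the
     symbol of [q ^ (1 - N%:Z) * u / b]. *)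
  have x0 : b / u * q ^+ (N - c) != 0 by rewrite !mulf_neq0 ?invr_eq0 ?expf_neq0.
  have := poch_reflect c x0.
  have -> : (b / u * q ^+ (N - c))^-1 * q ^ (1 - c%:Z) = q ^ (1 - N%:Z) * u / b.
    have -> : 1 - N%:Z = - (N - c)%:Z + (1 - c%:Z) by lia.
    by rewrite (expfzDr (- (N - c)%:Z)) // -exprnN !invfM invrK; ring.
  move=> e.
  have f1 : poch (b * u) N = poch (b * u) c * poch (b * (u * q ^+ c)) (N - c).
    by rewrite mulrA -poch_cat subnKC.
  have f2 : poch (b / u) N = poch (b / u) (N - c) * poch (b / u * q ^+ (N - c)) c.
    by rewrite -poch_cat subnK.
  move: pk pk'; rewrite f1 f2 -e !mulf_eq0 !negb_or => /andP[h1 h2] /and4P[h3 h4 h5 h6].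
  (* The exponent is $c(N-1)=2\binom c2+(N-c)c$: one binomial belongs to the summand, the rest comes
     from the reflection. *)
  have -> : (- (q ^ (N%:Z - 1) * b)) ^+ c =
      q ^+ 'C(c, 2) * (q ^+ 'C(c, 2) * q ^+ ((N - c) * c)) * (- b) ^+ c.
    rewrite -mulrN exprMn -exprD -exprD; congr (_ * _).
    rewrite exprnP exprz_exp exprnP; congr (_ ^ _).
    by have := bin2_int c; clear -cN; nia.
  have -> : (- (b / u * q ^+ (N - c))) ^+ c = (- b) ^+ c / u ^+ c * q ^+ ((N - c) * c).
    by rewrite -!mulNr !exprMn exprVn exprM.
  have uc : u ^+ c != 0 by rewrite expf_neq0.
  have bc : (- b) ^+ c != 0 by rewrite expf_neq0 // oppr_eq0.
  have qc : q ^+ 'C(c, 2) != 0 by rewrite expf_neq0.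
  have qc' : q ^+ ((N - c) * c) != 0 by rewrite expf_neq0.
  by field; rewrite uc bc qc qc' h1 h2 h3 h4.
have e3 : \prod_k singlew (z k) (y k) =
    \prod_k (\prod_(x <- s) (poch (z k * x) (y k) * poch (z k / x) (y k))) *
    \prod_k (poch q (y k))^-1 by rewrite -big_split.
set A := \prod_k \prod_(x <- s) _ in e3.
set S := \prod_k (_ / _) in e2.
set E := \prod_k (\prod_j _)^-1 in e1.
have -> : \prod_(k < n)
      (q ^+ 'C(y k, 2) * z k ^+ y k
       * (\prod_(x <- s) (poch (z k * x) (y k) * poch (z k / x) (y k)))
       / (poch (b * z k) (y k) * poch (q ^ (1 - N%:Z) * z k / b) (y k)
          * \prod_(j < n) poch (q * z k / z j) (y k))) = S * A * E.
  rewrite -!big_split; apply: eq_bigr => k _ /=; rewrite !invfM.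
  move: (\prod_(x <- s) _) => ?; move: (\prod_(j < n) _) => ?.
  by ring.
clearbody V S A E; rewrite /coefD e3.
transitivity (A * (S * (V * E))); first by ring.
by rewrite e1 e2; ring.
Qed.

End Multisum.
End EllipticAlgebra.

Local Open Scope classical_set_scope.

(** * Geometric convergence in [R[i]] *)

Section ComplexModulus.
Variable R : realType.
Implicit Types (x y z : R[i]).

(** The norm of [R[i]] has values in [R[i]]; a modulus in [R] gives access to total order and real
    analysis. *)
Definition modc z : R := complex.Re `|z|.

Lemma modcE z : `|z| = (modc z)%:C%C.
Proof. by rewrite /modc RRe_real // normr_real. Qed.

Lemma modc_ge0 z : 0 <= modc z.
Proof. by rewrite -ler0c -modcE. Qed.

Lemma modcM x y : modc (x * y) = modc x * modc y.
Proof. by apply: complexI; rewrite rmorphM /= -!modcE normrM. Qed.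

Lemma modc1 : modc 1 = 1.
Proof. by apply: complexI; rewrite -modcE normr1. Qed.

Lemma modc0 : modc 0 = 0.
Proof. by apply: complexI; rewrite -modcE normr0. Qed.

Lemma modcX x n : modc (x ^+ n) = modc x ^+ n.
Proof. by elim: n => [|n IH]; rewrite ?modc1 // !exprS modcM IH. Qed.

Lemma modcV x : modc x^-1 = (modc x)^-1.
Proof. by apply: complexI; rewrite fmorphV /= -!modcE normfV. Qed.

Lemma modc_exprz x (m : int) : modc (x ^ m) = modc x ^ m.
Proof. by case: m => n; rewrite ?NegzE -?exprnP -?exprnN ?modcV modcX. Qed.

Lemma modcN x : modc (- x) = modc x.
Proof. by apply: complexI; rewrite -!modcE normrN. Qed.

Lemma modcB x y : modc (x - y) = modc (y - x).
Proof. by rewrite -modcN opprB. Qed.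

Lemma modc_eq0 x : (modc x == 0) = (x == 0).
Proof. by rewrite -(inj_eq (@complexI R)) -modcE normr_eq0. Qed.

Lemma modc_gt0 x : (0 < modc x) = (x != 0).
Proof. by rewrite lt0r modc_ge0 andbT modc_eq0. Qed.

Lemma modcD x y : modc (x + y) <= modc x + modc y.
Proof. by rewrite -lecR rmorphD /= -!modcE ler_normD. Qed.

Lemma modc_sum I (r : seq I) (P : pred I) (F : I -> R[i]) :
  modc (\sum_(i <- r | P i) F i) <= \sum_(i <- r | P i) modc (F i).
Proof.
elim/big_rec2: _ => [|i a b _ h]; first by rewrite modc0.
by apply: le_trans (modcD _ _) _; rewrite lerD2l.
Qed.

Lemma modc_i : modc ('i)%C = 1.
Proof.
by apply: complexI; rewrite -modcE normc_def /= expr0n /= add0r expr1n sqrtr1.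
Qed.

Lemma modc_ReIm z : modc z <= `|complex.Re z| + `|complex.Im z|.
Proof.
rewrite {1}[z]complexE; apply: le_trans (modcD _ _) _.
have h (a : R) : modc a%:C%C = `|a|.
  by apply: complexI; rewrite -modcE normc_def /= expr0n /= addr0 sqrtr_sqr.
by rewrite modcM modc_i mul1r !h.
Qed.

Lemma Re_le_modc z : `|complex.Re z| <= modc z.
Proof. by rewrite -lecR -modcE normc_ge_Re. Qed.

Lemma Im_le_modc z : `|complex.Im z| <= modc z.
Proof.
have := Re_le_modc (z * ('i)%C); rewrite ReiNIm normrN modcM.
by rewrite modc_i mulr1.
Qed.

Lemma cvg_modc (u : nat -> R[i]^o) (l : R[i]^o) :
  (fun n => modc (u n - l)) @ \oo --> (0 : R) -> u @ \oo --> l.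
Proof.
move=> /cvgrPdist_lt h; apply/cvgrPdist_lt => e e0.
have eE : e = (complex.Re e)%:C%C by rewrite RRe_real // gtr0_real.
have e0' : 0 < complex.Re e by rewrite -ltcR -eE.
have := h _ e0'; apply: filterS => n.
by rewrite sub0r normrN ger0_norm ?modc_ge0 // => hn; rewrite eE distrC modcE ltcR.
Qed.

Section Geometric.
Variables (r : R) (r_gt0 : 0 < r) (r_lt1 : r < 1).

Lemma geo_ge0 n : 0 <= r ^+ n. Proof. by rewrite exprn_ge0 // ltW. Qed.

Lemma geo_le m n : (m <= n)%N -> r ^+ n <= r ^+ m.
Proof. by move=> mn; rewrite ler_wiXn2l // ltW. Qed.

Lemma geo_cvg0 (K : R) : (fun n => K * r ^+ n) @ \oo --> (0 : R).
Proof. by apply: (@cvg_geometric _ K r); rewrite ger0_norm // ltW. Qed.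

Lemma cvg_geo_close (u v : nat -> R[i]^o) (l : R[i]^o) (K : R) :
  (forall n, modc (u n - v n) <= K * r ^+ n) -> u @ \oo --> l -> v @ \oo --> l.
Proof.
move=> h ul.
have h0 : (fun n => v n - u n : R[i]^o) @ \oo --> (0 : R[i]^o).
  apply: cvg_modc; apply: (@squeeze_cvgr _ _ _ _ (fun=> 0) (fun n => K * r ^+ n)).
  - by apply: nearW => n; rewrite modc_ge0 subr0 modcB h.
  - exact: cvg_cst.
  - exact: geo_cvg0.
have -> : v = (fun n => u n + (v n - u n)) by apply/funext => n; rewrite addrC subrK.
have uv := @cvgD R[i] R[i]^o _ _ _ u (fun n => v n - u n) l 0 ul h0.
by rewrite addr0 in uv; exact: (uv _).
Qed.

Lemma geo_cvg_real (u : nat -> R) (K : R) :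
  (forall n, `|u n.+1 - u n| <= K * r ^+ n) -> cvgn u.
Proof.
move=> h.
have hs : cvgn (series (fun n => u n.+1 - u n)).
  apply: (@normed_cvg _ R^o); rewrite /normed_series_of /=.
  apply: (@series_le_cvg _ _ (geometric K r)) => //.
  - by move=> n; exact: le_trans (h n).
  - by apply: is_cvg_geometric_series; rewrite ger0_norm // ltW.
have -> : u = (fun n => series (fun n => u n.+1 - u n) n + u 0%N).
  by apply/funext => n; rewrite /series /= telescope_sumr // subrK.
by apply: is_cvgD => //; exact: is_cvg_cst.
Qed.

Lemma geo_cvg (u : nat -> R[i]^o) (K : R) :
  (forall n, modc (u n.+1 - u n) <= K * r ^+ n) -> cvgn u.
Proof.
move=> h.
have ReB (x y : R[i]) : complex.Re (x - y) = complex.Re x - complex.Re y.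
  by rewrite raddfB.
have ImB (x y : R[i]) : complex.Im (x - y) = complex.Im x - complex.Im y.
  by rewrite raddfB.
have /cvg_ex[/= a ha] : cvgn (fun n => complex.Re (u n)).
  apply: (@geo_cvg_real _ K) => n; rewrite -ReB.
  by apply: le_trans (Re_le_modc _) (h n).
have /cvg_ex[/= b hb] : cvgn (fun n => complex.Im (u n)).
  apply: (@geo_cvg_real _ K) => n; rewrite -ImB.
  by apply: le_trans (Im_le_modc _) (h n).
apply/cvg_ex; exists (Complex a b : R[i]^o); apply: cvg_modc.
apply: (@squeeze_cvgr _ _ _ _ (fun=> 0)
    (fun n => `|complex.Re (u n) - a| + `|complex.Im (u n) - b|)).
- apply: nearW => n; rewrite modc_ge0 /=.
  by apply: le_trans (modc_ReIm _) _; rewrite ReB ImB.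
- exact: cvg_cst.
- rewrite -[X in _ --> X](addr0 (0 : R)); apply: cvgD.
    by rewrite -(normr0 R) -(subrr a); apply: cvg_norm; apply: cvgB => //; apply: cvg_cst.
  by rewrite -(normr0 R) -(subrr b); apply: cvg_norm; apply: cvgB => //; apply: cvg_cst.
Qed.

Definition modc_bounded (u : nat -> R[i]) := exists K, forall n, modc (u n) <= K.
Definition geo_close (u v : nat -> R[i]) := exists K, forall n, modc (u n - v n) <= K * r ^+ n.

Lemma modc_boundedM u v : modc_bounded u -> modc_bounded v -> modc_bounded (fun n => u n * v n).
Proof.
move=> [K hK] [L hL]; exists (K * L) => n; rewrite modcM.
by apply: ler_pM => //; apply: modc_ge0.
Qed.

Lemma geo_close_trans u v w : geo_close u v -> geo_close v w -> geo_close u w.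
Proof.
move=> [K hK] [L hL]; exists (K + L) => n.
have -> : u n - w n = (u n - v n) + (v n - w n) by ring.
by apply: le_trans (modcD _ _) _; rewrite mulrDl lerD.
Qed.

Lemma geo_close_bounded u v : geo_close u v -> modc_bounded v -> modc_bounded u.
Proof.
move=> [K hK] [L hL]; exists (`|K| + L) => n.
have -> : u n = (u n - v n) + v n by ring.
apply: le_trans (modcD _ _) _; apply: lerD => //.
apply: le_trans (hK n) _; apply: le_trans (ler_norm _) _.
rewrite normrM (ger0_norm (geo_ge0 n)) -[leRHS]mulr1 ler_wpM2l //.
by rewrite -[leRHS](expr0 r) geo_le.
Qed.

Lemma geo_closeM u v w : modc_bounded w -> geo_close u v ->
  geo_close (fun n => w n * u n) (fun n => w n * v n).
Proof.
move=> [L hL] [K hK]; exists (L * K) => n; rewrite -mulrBr modcM -mulrA.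
by apply: ler_pM => //; apply: modc_ge0.
Qed.

Lemma geo_closeMM u v u' v' : modc_bounded v -> modc_bounded u' -> geo_close u v -> geo_close u' v' ->
  geo_close (fun n => u n * u' n) (fun n => v n * v' n).
Proof.
move=> bv bu' h h'.
have h1 : geo_close (fun n => u n * u' n) (fun n => v n * u' n).
  case: (geo_closeM bu' h) => K hK; exists K => n.
  by rewrite (mulrC (u n)) (mulrC (v n)).
exact: geo_close_trans h1 (geo_closeM bv h').
Qed.

Lemma geo_sum_le n : \sum_(i < n) r ^+ i <= (1 - r)^-1.
Proof.
have r1 : 0 < 1 - r by rewrite subr_gt0.
rewrite -(ler_pM2l r1) mulfV ?gt_eqF //.
have -> : (1 - r) * \sum_(i < n) r ^+ i = 1 - r ^+ n.
  by rewrite -opprB mulNr -subrX1 opprB.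
by have := geo_ge0 n; lra.
Qed.

(** By $1+s\le e^s$, the product is bounded by the exponential of a geometric sum. *)
Lemma prod_bounded (a : nat -> R[i]) (K : R) :
  (forall j, modc (a j) <= K * r ^+ j) -> modc_bounded (fun n => \prod_(j < n) (1 + a j)).
Proof.
move=> h.
have K0 : 0 <= K by have := h 0%N; rewrite expr0 mulr1; apply: le_trans; exact: modc_ge0.
exists (expR (K / (1 - r))) => n.
apply: (@le_trans _ _ (expR (\sum_(j < n) K * r ^+ j))).
  elim: n => [|n IH]; first by rewrite !big_ord0 modc1 expR0.
  rewrite !big_ord_recr /= modcM expRD; apply: ler_pM; rewrite ?modc_ge0 //.
  apply: le_trans (expR_ge1Dx _); apply: le_trans (modcD _ _) _.
  by rewrite modc1 lerD2l.
by rewrite ler_expR -mulr_sumr ler_wpM2l // geo_sum_le.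
Qed.

Lemma prod_geo (a : nat -> R[i]) (K : R) :
  (forall j, modc (a j) <= K * r ^+ j) ->
  exists L, forall n, modc (\prod_(j < n.+1) (1 + a j) - \prod_(j < n) (1 + a j)) <= L * r ^+ n.
Proof.
move=> h; have [L hL] := prod_bounded h; exists (L * K) => n.
rewrite big_ord_recr /= mulrDr mulr1 addrC addKr modcM -mulrA.
by apply: ler_pM; [exact: modc_ge0 | exact: modc_ge0 | exact: hL | exact: h].
Qed.

Lemma geo_sum_center c : \sum_(i < (2 * c).+1) r ^+ `|(i : int) - c|%N <= 2 / (1 - r).
Proof.
have e : (2 * c).+1 = (c + c.+1)%N by lia.
rewrite e big_split_ord /= (mulrC 2) mulr2n mulrDr mulr1; apply: lerD.
  rewrite (reindex_inj rev_ord_inj) /=; apply: le_trans (geo_sum_le c).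
  by apply: ler_sum => i _; apply: geo_le; have := ltn_ord i; lia.
apply: le_trans (geo_sum_le c.+1); apply: ler_sum => i _; apply: geo_le.
by have := ltn_ord i; lia.
Qed.

Lemma geo_step (v : nat -> R[i]) (K : R) k l : (k <= l)%N ->
  (forall n, modc (v n.+1 - v n) <= K * r ^+ n) -> modc (v l - v k) <= K / (1 - r) * r ^+ k.
Proof.
move=> kl h; rewrite -(subnK kl); set d := (l - k)%N.
have K0 : 0 <= K by have := h 0%N; rewrite expr0 mulr1; apply: le_trans; exact: modc_ge0.
apply: (@le_trans _ _ (K * r ^+ k * \sum_(i < d) r ^+ i)).
  elim: d => [|d IH]; first by rewrite big_ord0 mulr0 add0n subrr modc0.
  rewrite big_ord_recr /= addSn.
  have -> : v (d + k).+1 - v k = (v (d + k).+1 - v (d + k)) + (v (d + k) - v k) by ring.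
  apply: le_trans (modcD _ _) _; rewrite mulrDr addrC; apply: lerD => //.
  by rewrite -mulrA -exprD (addnC k).
rewrite -!mulrA ler_wpM2l // mulrC ler_wpM2r ?geo_ge0 //.
exact: geo_sum_le.
Qed.

(** Once [t ^+ N * Y] is at most 1, so is [(t ^+ n * Y) ^+ n] for every [n] beyond [N]; below [N] a
    power of [Y] suffices. *)
Lemma gauss_bound (t Y : R) : 0 < t -> t < 1 -> 0 < Y ->
  exists K, forall n, t ^+ (n * n) * Y ^+ n <= K.
Proof.
move=> t0 t1 Y0.
have [N hN] : exists N, t ^+ N * Y <= 1.
  have := @cvg_geometric R Y t; rewrite ger0_norm ?(ltW t0) // => /(_ t1).
  move=> /cvgrPdist_lt /(_ 1 ltr01) [N _ /(_ N)] /= h.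
  exists N; have := h (leqnn N); rewrite sub0r normrN mulrC.
  by move=> /ltW; apply: le_trans; apply: ler_norm.
exists (Num.max 1 Y ^+ N) => n.
have Y1 : 1 <= Num.max 1 Y by rewrite le_max lexx.
have [nN|Nn] := leqP n N.
  apply: (@le_trans _ _ (Y ^+ n)).
    by rewrite -[leRHS]mul1r ler_wpM2r ?exprn_ge0 ?exprn_ile1 // ltW.
  apply: (@le_trans _ _ (Num.max 1 Y ^+ n)); last by rewrite ler_weXn2l.
  by apply: lerXn2r; rewrite ?nnegrE ?le_max ?lexx ?orbT ?ler01 ?(ltW Y0).
rewrite exprM -exprMn; apply: (@le_trans _ _ 1); last by rewrite exprn_ege1.
apply: exprn_ile1; first by rewrite mulr_ge0 ?exprn_ge0 ?ltW.
apply: le_trans hN; rewrite ler_wpM2r ?(ltW Y0) //; apply: ler_wiXn2l; [exact: ltW|exact: ltW|exact: ltnW].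
Qed.

End Geometric.
End ComplexModulus.

(** * The finite Jacobi triple product *)

Section QBinomial.
Variables (K : fieldType) (p : K).
Definition qfact k := \prod_(j < k) (1 - p ^+ j.+1).
Hypothesis qfact_neq0 : forall k, qfact k != 0.

Lemma qfact0 : qfact 0 = 1.
Proof. by rewrite /qfact big_ord0. Qed.

Lemma qfactS k : qfact k.+1 = qfact k * (1 - p ^+ k.+1).
Proof. by rewrite /qfact big_ord_recr. Qed.

Lemma qbinomial_thm n y : \prod_(j < n) (1 + y * p ^+ j) =
  \sum_(k < n.+1) qfact n / (qfact k * qfact (n - k)) * p ^+ 'C(k, 2) * y ^+ k.
Proof.
(* Extending the coefficients by zero lets the q-Pascal rule [cS] hold for all indices, including
   the top one. *)
pose c n k := if (k <= n)%N then qfact n / (qfact k * qfact (n - k)) * p ^+ 'C(k, 2) else 0.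
have cS m k : c m.+1 k.+1 = c m k.+1 + p ^+ m * c m k.
  rewrite /c ltnS; case: (leqP k m) => km; last first.
    by rewrite ltnNge (ltnW km) /= mulr0 addr0.
  rewrite binS bin1 subSS exprD.
  case: ltngtP km => // [km | ->] _.
    have e : (m = (m - k.+1) + k.+1)%N by rewrite subnK.
    move: e; set d := (m - k.+1)%N => e.
    have -> : (m - k = d.+1)%N by lia.
    have := qfact_neq0 k; have := qfact_neq0 d; have := qfact_neq0 m.+1.
    have := qfact_neq0 k.+1; have := qfact_neq0 d.+1; rewrite !qfactS.
    rewrite !mulf_eq0 !negb_or => /andP[_ h1] /andP[_ h2] /andP[h3 _] h4 h5.
    have -> : p ^+ m.+1 = p ^+ d * p ^+ k.+1 * p by rewrite e exprS exprD; ring.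
    have -> : p ^+ m = p ^+ d * p ^+ k.+1 by rewrite e exprD.
    rewrite !exprS in h1 h2 *.
    by field; rewrite h1 h2 h4 h5.
  rewrite !subnn add0r qfact0 !mulr1.
  by rewrite !divff ?qfact_neq0 //; ring.
have c0 m : c m 0%N = 1.
  by rewrite /c leq0n subn0 qfact0 mul1r divff // mul1r.
rewrite (eq_bigr (fun k : 'I_n.+1 => c n k * y ^+ k)); last first.
  by move=> k _; rewrite /c -ltnS ltn_ord.
elim: n => [|n IH]; first by rewrite big_ord0 big_ord_recl big_ord0 c0 mulr1 addr0.
rewrite big_ord_recr /= IH.
have cn : c n n.+1 = 0 by rewrite /c ltnn.
rewrite [RHS]big_ord_recl c0.
rewrite [X in _ = _ + X](eq_bigr (fun k : 'I_n.+1 =>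
    c n k.+1 * y ^+ k.+1 + y * p ^+ n * (c n k * y ^+ k))); last first.
  by move=> k _; rewrite lift0 cS exprS; ring.
rewrite big_split /= -mulr_sumr addrA.
have -> : 1 * y ^+ 0 + \sum_(i < n.+1) c n i.+1 * y ^+ i.+1 = \sum_(k < n.+1) c n k * y ^+ k.
  transitivity (\sum_(k < n.+2) c n k * y ^+ k); last first.
    by rewrite big_ord_recr /= cn mul0r addr0.
  by rewrite [RHS]big_ord_recl c0.
by ring.
Qed.

End QBinomial.

Section TripleProduct.
Variables (K : fieldType) (t x : K).
Hypotheses (t_neq0 : t != 0) (x_neq0 : x != 0).
Let p := t ^+ 2.
Hypothesis qfact_neq0 : forall k, qfact p k != 0.

(** A term of the Jacobi theta series. Writing $p^{\binom m2}(-x)^m$ as $t^{m^2}(-x/t)^m$ with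
    $t^2=p$ makes the exponent a pure square. *)
Definition gauss (s y : K) (m : int) : K := s ^ (m * m) * y ^ m.

(** The q-binomial coefficient of [2 * M] over [i] divided by the central one, hence close to 1 for
    [i] far from both ends. *)
Definition qratio (a : K) M i := qfact a M ^+ 2 / (qfact a i * qfact a (2 * M - i)).

Lemma triple_product M :
  \prod_(j < M) ((1 - p ^+ j * x) * (1 - p ^+ j.+1 / x)) =
  qfact p (2 * M) / qfact p M ^+ 2 *
  \sum_(i < (2 * M).+1) qratio p M i * gauss t (- (x / t)) (i%:Z - M%:Z).
Proof.
have p0 : p != 0 by rewrite expf_neq0.
(* This value centers the q-binomial product of length [2 * M]: its upper half is the product of
   [1 - p ^+ j * x], and its lower half, reversed, is that of [1 - p ^+ j.+1 / x] times [A]. *)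
pose y := - x / p ^+ M.
pose A := \prod_(j < M) (- x / p ^+ j.+1).
have A0 : A != 0.
  by apply/prodf_neq0 => j _; rewrite mulf_neq0 ?oppr_eq0 ?invr_eq0 ?expf_neq0.
have e1 : \prod_(j < 2 * M) (1 + y * p ^+ j) =
    A * \prod_(j < M) ((1 - p ^+ j * x) * (1 - p ^+ j.+1 / x)).
  have -> : (2 * M = M + M)%N by lia.
  rewrite big_split_ord /= (reindex_inj rev_ord_inj) /= big_split /=.
  rewrite [RHS]mulrCA [LHS]mulrC /A -[X in _ = _ * X]big_split.
  congr (_ * _); apply: eq_bigr => j _ /=.
    by rewrite exprD /y; field; rewrite expf_neq0.
  rewrite /y; have -> : p ^+ M = p ^+ (M - j.+1) * p ^+ j.+1 by rewrite -exprD subnK.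
  by field; rewrite x_neq0 !expf_neq0.
have AE : A = (- x) ^+ M * t ^ (- (M%:Z * M%:Z + M%:Z)).
  rewrite /A; elim: (M) => [|m IH]; first by rewrite big_ord0 expr0 mul1r.
  rewrite big_ord_recr /= IH (exprS (- x)).
  have -> : (- (m.+1%:Z * m.+1%:Z + m.+1%:Z)) = - (m%:Z * m%:Z + m%:Z) + - (2 * m.+1)%:Z by lia.
  by rewrite expfzDr // -exprnN /p -exprM; ring.
have e2 (i : nat) : p ^+ 'C(i, 2) * y ^+ i =
   (- x) ^+ M * t ^ (- (M%:Z * M%:Z + M%:Z)) *
   (t ^ ((i%:Z - M%:Z) * (i%:Z - M%:Z)) * (- (x / t)) ^ (i%:Z - M%:Z)).
  have nx0 : - x != 0 by rewrite oppr_eq0.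
  have -> : - (x / t) = - x * t ^ (-1) by rewrite -mulNr.
  rewrite exprzMl ?unitfE ?invr_eq0 // exprz_exp.
  rewrite [_ ^+ M]exprnP.
  transitivity ((- x) ^ i%:Z * t ^ ((i%:Z * i%:Z - i%:Z) + - (2 * M * i)%:Z)).
    rewrite /y expfzDr // -exprnN -exprnP expr_div_n -!exprM.
    by rewrite bin2_int -exprnP mulnA mulrCA.
  have -> : (- x) ^ i%:Z = (- x) ^ M%:Z * (- x) ^ (i%:Z - M%:Z).
    by rewrite -expfzDr // addrC subrK.
  have -> : i%:Z * i%:Z - i%:Z + - (2 * M * i)%:Z =
    - (M%:Z * M%:Z + M%:Z) + ((i%:Z - M%:Z) * (i%:Z - M%:Z) + -1 * (i%:Z - M%:Z)) by lia.
  set D := i%:Z - M%:Z; rewrite (expfzDr _ _ t_neq0) (expfzDr (D * D) _ t_neq0); ring.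
apply: (mulfI A0); rewrite -e1 qbinomial_thm // !mulr_sumr; apply: eq_bigr => i _.
rewrite /qratio /gauss AE.
set a := qfact p (2 * M); set b := qfact p M; set c := qfact p i; set d := qfact p (_ - _).
have [b0 c0 d0] : [/\ b != 0, c != 0 & d != 0] by split; exact: qfact_neq0.
transitivity (a / (c * d) * (p ^+ 'C(i, 2) * y ^+ i)); first by ring.
by rewrite e2; field; rewrite b0 c0 d0.
Qed.

End TripleProduct.

(** * The theta function *)

Section Theta.
Variables (R : realType) (p : R[i]) (r : R).
Hypotheses (r_gt0 : 0 < r) (r_lt1 : r < 1) (p_le : modc p <= r).

Lemma modc_pX_le n : modc (p ^+ n) <= r ^+ n.
Proof. by rewrite modcX lerXn2r ?nnegrE ?modc_ge0 // ltW. Qed.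

Lemma cvg_pX0 : (fun n => p ^+ n : R[i]^o) @ \oo --> (0 : R[i]^o).
Proof.
apply: (@cvg_geo_close R r r_gt0 r_lt1 (fun=> 0) (fun n => p ^+ n) 0 1); last exact: cvg_cst.
by move=> n; rewrite sub0r modcN mul1r modc_pX_le.
Qed.

Definition thetaN x M : R[i]^o := \prod_(j < M) ((1 - p ^+ j * x) * (1 - p ^+ j.+1 / x)).

Lemma thetaN_cvg x : thetaN x @ \oo --> (theta p x : R[i]^o).
Proof.
have h j : modc ((1 - p ^+ j * x) * (1 - p ^+ j.+1 / x) - 1) <=
    (modc x + modc x^-1 + 1) * r ^+ j.
  have -> : (1 - p ^+ j * x) * (1 - p ^+ j.+1 / x) - 1 =
      - (p ^+ j * x) + (- (p ^+ j.+1 * x^-1) + p ^+ j.+1 * (p ^+ j * (x * x^-1))) by ring.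
  have pj : modc (p ^+ j.+1) <= r ^+ j.
    by apply: le_trans (modc_pX_le _) _; apply: geo_le.
  have px : modc (x * x^-1) <= 1.
    (* Convergence holds for [x = 0] too, as [0^-1] is 0. *)
    have [->|x0] := eqVneq x 0; first by rewrite mul0r modc0.
    by rewrite divff // modc1.
  have pj1 : modc (p ^+ j) <= 1.
    by apply: le_trans (modc_pX_le _) _; rewrite exprn_ile1 // ltW.
  apply: le_trans (modcD _ _) _; rewrite modcN mulrDl mulrDl -addrA.
  apply: lerD; first by rewrite modcM mulrC ler_wpM2l ?modc_ge0 // modc_pX_le.
  apply: le_trans (modcD _ _) _; rewrite modcN; apply: lerD.
    by rewrite modcM mulrC ler_wpM2l ?modc_ge0.
  rewrite modcM mulrC; apply: ler_pM => //; rewrite ?modc_ge0 //.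
  by rewrite modcM -[leRHS]mulr1; apply: ler_pM => //; rewrite ?modc_ge0.
have [L hL] := prod_geo r_gt0 r_lt1 h.
have e M : thetaN x M = \prod_(j < M) (1 + ((1 - p ^+ j * x) * (1 - p ^+ j.+1 / x) - 1)).
  by apply: eq_bigr => j _; rewrite [RHS]addrC subrK.
have : cvgn (thetaN x).
  by apply: (@geo_cvg _ r r_gt0 r_lt1 _ L) => M; rewrite !e.
exact.
Qed.

(** The partial products at [x] and [x^-1] satisfy the relation exactly up to factors
    [1 - p ^+ M * x] and [1 - p ^+ M * x^-1], which tend to 1. Multiplying by [1 - x] avoids a
    division at [x = 1]. *)
Lemma thetaV_mul x : x != 0 -> (1 - x) * theta p x^-1 = (1 - x^-1) * theta p x.
Proof.
move=> x0.
pose A y M := \prod_(j < M) (1 - p ^+ j * y) : R[i].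
have AS y M : A y M * (1 - p ^+ M * y) = (1 - y) * A (p * y) M.
  rewrite -[LHS](big_ord_recr M (fun j => 1 - p ^+ j * y)) big_ord_recl mul1r; congr (_ * _).
  by apply: eq_bigr => j _; rewrite lift0 exprSr mulrA.
have tA y M : thetaN y M = A y M * A (p * y^-1) M.
  by rewrite /thetaN big_split; congr (_ * _); apply: eq_bigr => j _; rewrite exprSr mulrA.
have hA M : (1 - x) * (thetaN x^-1 M * (1 - p ^+ M * x^-1)) =
    (1 - x^-1) * (thetaN x M * (1 - p ^+ M * x)).
  rewrite !tA invrK.
  transitivity (A x^-1 M * (1 - p ^+ M * x^-1) * ((1 - x) * A (p * x) M)); first by ring.
  by rewrite -AS AS; ring.
have h (y c : R[i]) : (fun M => c * (thetaN y M * (1 - p ^+ M * y)) : R[i]^o) @ \oo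
    --> (c * theta p y : R[i]^o).
  have e : c * theta p y = c * (theta p y * (1 - 0 * y)) by rewrite mul0r subr0 mulr1.
  rewrite [X in _ --> X]e.
  apply: (@cvgM R[i] _ _ _ (fun=> c) (fun M => thetaN y M * (1 - p ^+ M * y))).
    exact: cvg_cst.
  apply: (@cvgM R[i] _ _ _ (thetaN y) (fun M => 1 - p ^+ M * y)); first exact: thetaN_cvg.
  apply: (@cvgB R[i] R[i]^o _ _ _ (fun=> 1) (fun M => p ^+ M * y)); first exact: cvg_cst.
  apply: (@cvgM R[i] _ _ _ (fun M => p ^+ M) (fun=> y)); [exact: cvg_pX0 | exact: cvg_cst].
have h1 := h x^-1 (1 - x); have h2 := h x (1 - x^-1).
move: h1; under eq_fun do rewrite hA.
by move=> h1; apply: (cvg_unique _ h1 h2).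
Qed.

Lemma theta1 : theta p 1 = 0.
Proof.
apply: (@cvg_unique R[i]^o (@norm_hausdorff _ _) (thetaN 1 @ \oo)); first exact: thetaN_cvg.
apply: (@cvg_geo_close _ r r_gt0 r_lt1 (fun=> 0) _ _ 1); last exact: cvg_cst.
case=> [|n].
  by rewrite /thetaN big_ord0 sub0r modcN modc1 expr0 mulr1.
by rewrite /thetaN big_ord_recl mulr1 subrr !mul0r subrr modc0 mul1r; apply: geo_ge0.
Qed.

Lemma thetaV x : x != 0 -> theta p x^-1 = - x^-1 * theta p x.
Proof.
move=> x0; have [->|x1] := eqVneq x 1; first by rewrite invr1 theta1 mulr0.
have x1' : 1 - x != 0 by rewrite subr_eq0 eq_sym.
by apply: (mulfI x1'); rewrite thetaV_mul //; field.
Qed.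

End Theta.

(** The coordinates are $m+n$ and $m-n$, translated by [2 * M] to remain natural numbers. The image
    of the square is the set of points of equal parity in a rotated square. *)
Lemma sum_square_parity (V : nmodType) (M : nat) (F : nat -> nat -> V) :
  \sum_(v : 'I_(2 * M).+1 * 'I_(2 * M).+1) F (v.1 + v.2)%N (v.1 + 2 * M - v.2)%N =
  \sum_(w : 'I_(4 * M).+1 * 'I_(4 * M).+1 | (odd w.1 == odd w.2) &&
     [&& 2 * M <= w.1 + w.2, w.1 + w.2 <= 6 * M, w.2 <= w.1 + 2 * M & w.1 <= w.2 + 2 * M]%N)
    F w.1 w.2.
Proof.
pose h (v : 'I_(2 * M).+1 * 'I_(2 * M).+1) : 'I_(4 * M).+1 * 'I_(4 * M).+1 :=
  (inord (v.1 + v.2), inord (v.1 + 2 * M - v.2)).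
pose h' (w : 'I_(4 * M).+1 * 'I_(4 * M).+1) : 'I_(2 * M).+1 * 'I_(2 * M).+1 :=
  (inord (w.1 + w.2 - 2 * M)./2, inord (w.1 + 2 * M - w.2)./2).
have h1 (v : 'I_(2 * M).+1 * 'I_(2 * M).+1) : (h v).1 = (v.1 + v.2)%N :> nat.
  by rewrite inordK //; have := ltn_ord v.1; have := ltn_ord v.2; clear; lia.
have h2 (v : 'I_(2 * M).+1 * 'I_(2 * M).+1) : (h v).2 = (v.1 + 2 * M - v.2)%N :> nat.
  by rewrite inordK //; have := ltn_ord v.1; have := ltn_ord v.2; clear; lia.
rewrite [RHS](reindex_onto h h') /=; last first.
  move=> w /andP[/eqP pw /and4P[w1 w2 w3 w4]].
  have a1 : (h' w).1 = (w.1 + w.2 - 2 * M)./2 :> nat.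
    by rewrite inordK //; clear -w1 w2 w3 w4 pw; lia.
  have a2 : (h' w).2 = (w.1 + 2 * M - w.2)./2 :> nat.
    by rewrite inordK //; clear -w1 w2 w3 w4 pw; lia.
  rewrite [w in RHS]surjective_pairing [LHS]surjective_pairing; congr pair; apply/val_inj.
    by rewrite [LHS]h1 a1 a2 /=; clear -w1 w2 w3 w4 pw; lia.
  by rewrite [LHS]h2 a1 a2 /=; clear -w1 w2 w3 w4 pw; lia.
apply: eq_big => [v | v _]; last by rewrite h1 h2.
have v1 := ltn_ord v.1; have v2 := ltn_ord v.2.
symmetry; apply/andP; split.
  rewrite h1 h2; apply/andP; split; first by apply/eqP; clear -v1 v2; lia.
  by clear -v1 v2; lia.
apply/eqP; rewrite [v in RHS]surjective_pairing [LHS]surjective_pairing; congr pair; apply/val_inj.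
  by rewrite /= inordK h1 h2; clear -v1 v2; lia.
by rewrite /= inordK h1 h2; clear -v1 v2; lia.
Qed.

Lemma absz_sqr (m : int) : m * m = (`|m| * `|m|)%N.
Proof. by lia. Qed.

(** Trades half of the Gaussian decay for [r ^+ M]: near the ends of the range [qratio] is poorly
    controlled, but the Gaussian term is small there. *)
Lemma absz_center i M : (i <= 2 * M)%N ->
  (M + `|i%:Z - M%:Z| <= minn i (2 * M - i) + 2 * `|i%:Z - M%:Z|)%N.
Proof. by lia. Qed.

(** Outside the rotated square the absolute values sum to more than [2 * M], so half of the decay
    yields [r ^+ M] and the other half stays summable. *)
Lemma absz_outside S D M :
  ~~ [&& 2 * M <= S + D, S + D <= 6 * M, D <= S + 2 * M & S <= D + 2 * M]%N ->
  (M + (`|S%:Z - (2 * M)%:Z| + `|D%:Z - (2 * M)%:Z|) <=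
   2 * `|S%:Z - (2 * M)%:Z| + 2 * `|D%:Z - (2 * M)%:Z|)%N.
Proof. by lia. Qed.

(** * Rank-two approximation of the product of two theta functions *)

Section Plucker.
Variables (R : realType) (p t rho : R[i]) (r : R).
Hypotheses (r_gt0 : 0 < r) (r_lt1 : r < 1) (p_le : modc p <= r).
Hypotheses (p_neq0 : p != 0) (tE : t ^+ 2 = p) (rhoE : rho ^+ 2 = t).

Let geo0 n : 0 <= r ^+ n := geo_ge0 r_gt0 n.
Let r1 : 0 < 1 - r. Proof. by rewrite subr_gt0. Qed.

Lemma modc_1subp_ge j : 1 - r <= modc (1 - p ^+ j.+1).
Proof.
have h1 := modcD (1 - p ^+ j.+1) (p ^+ j.+1).
rewrite subrK modc1 in h1.
have h2 := modc_pX_le r_gt0 p_le j.+1.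
have h3 : r ^+ j.+1 <= r by rewrite -[leRHS]expr1 (geo_le r_gt0 r_lt1).
by lra.
Qed.

Lemma qfact_neq0 k : qfact p k != 0.
Proof.
apply/prodf_neq0 => j _; rewrite -modc_gt0.
exact: lt_le_trans r1 (modc_1subp_ge j).
Qed.

Let qfact_term j : modc (- p ^+ j.+1) <= 1 * r ^+ j.
Proof.
rewrite modcN mul1r; apply: le_trans (modc_pX_le r_gt0 p_le _) _.
exact: (geo_le r_gt0 r_lt1).
Qed.

Lemma qfact_bounded : modc_bounded (qfact p).
Proof. exact: (prod_bounded r_gt0 r_lt1 qfact_term). Qed.

Lemma qfactV_bounded : modc_bounded (fun k => (qfact p k)^-1).
Proof.
have h j : modc (p ^+ j.+1 / (1 - p ^+ j.+1)) <= (1 - r)^-1 * r ^+ j.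
  rewrite modcM mulrC modcV; apply: ler_pM; rewrite ?invr_ge0 ?modc_ge0 //.
    have hj := modc_1subp_ge j.
    by rewrite lef_pV2 ?posrE // (lt_le_trans r1).
  by have := qfact_term j; rewrite modcN mul1r.
have [K hK] := prod_bounded r_gt0 r_lt1 h; exists K => n.
have := hK n; congr (modc _ <= _); rewrite /qfact -prodfV; apply: eq_bigr => j _.
have : 1 - p ^+ j.+1 != 0 by rewrite -modc_gt0; exact: lt_le_trans r1 (modc_1subp_ge j).
by move=> h0; field.
Qed.

(** [qfact p] varies by O(r^m) beyond the index [m] and has bounded inverses; the deviation from 1
    splits into two such variations. *)
Lemma qratio_close : exists K, forall M i m, (i <= 2 * M)%N -> (m <= i)%N -> (m <= 2 * M - i)%N ->
  modc (qratio p M i - 1) <= K * r ^+ m.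
Proof.
have [B hB] := qfact_bounded; have [B' hB'] := qfactV_bounded.
have [L hL] := prod_geo r_gt0 r_lt1 qfact_term.
pose D := L / (1 - r).
have L0 : 0 <= L.
  by have := hL 0%N; rewrite expr0 mulr1; apply: le_trans; exact: modc_ge0.
have D0 : 0 <= D by rewrite divr_ge0 // ltW.
have hD k l m : (m <= k)%N -> (m <= l)%N -> modc (qfact p k - qfact p l) <= D * r ^+ m.
  wlog kl : k l / (k <= l)%N => [h mk ml|mk ml].
    by have [kl|/ltnW kl] := leqP k l; [|rewrite modcB]; apply: h.
  rewrite modcB; apply: le_trans (geo_step r_gt0 r_lt1 kl hL) _.
  by rewrite ler_wpM2l // (geo_le r_gt0 r_lt1).
clearbody D; have B0 : 0 <= B by apply: le_trans (hB 0%N); exact: modc_ge0.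
have B0' : 0 <= B' by apply: le_trans (hB' 0%N); exact: modc_ge0.
exists ((B * D + B * D) * (B' * B')) => M i m iM mi mj.
have mM : (m <= M)%N by clear -mi mj; lia.
rewrite /qratio; set j := (2 * M - i)%N in mj *.
have -> : qfact p M ^+ 2 / (qfact p i * qfact p j) - 1 =
   (qfact p M * (qfact p M - qfact p i) + qfact p i * (qfact p M - qfact p j)) *
   ((qfact p i)^-1 * (qfact p j)^-1).
  by field; rewrite !qfact_neq0.
rewrite modcM mulrAC; apply: ler_pM; rewrite ?modc_ge0 //.
  apply: le_trans (modcD _ _) _; rewrite mulrDl !modcM -!mulrA.
    by apply: lerD; apply: ler_pM; rewrite ?modc_ge0 ?hB ?hD //.
by rewrite modcM; apply: ler_pM; rewrite ?modc_ge0 ?hB'.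
Qed.

(** A quadratic exponent beats geometric growth. The factor 2 leaves one [r ^+ |m|] to absorb an
    error and another to sum over [m]. *)
Lemma gauss_le (s X : R[i]) : s != 0 -> modc s < 1 -> X != 0 ->
  exists2 K, 0 <= K & forall m : int, modc (gauss s X m) <= K * r ^+ (2 * `|m|).
Proof.
move=> s0 s1 X0.
have t0 : 0 < modc s by rewrite modc_gt0.
have Y0 : 0 < modc X by rewrite modc_gt0.
(* [Y] dominates [modc X] and its inverse, so one bound serves both signs of [m]. *)
pose Y := modc X + (modc X)^-1.
have Yp : 0 < Y by rewrite addr_gt0 ?invr_gt0.
have [K hK] := gauss_bound t0 s1 (divr_gt0 Yp (exprn_gt0 2 r_gt0)).
exists K => [|m].
  by apply: le_trans (hK 0%N); rewrite muln0 !expr0 mulr1.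
have hY : modc X ^ m <= Y ^+ `|m|.
  case: m => n; rewrite ?NegzE -?exprnP -?exprnN ?abszN ?absz_nat -?exprVn.
    by rewrite lerXn2r ?nnegrE ?(ltW Yp) ?(ltW Y0) // lerDl invr_ge0 ltW.
  by rewrite lerXn2r ?nnegrE ?(ltW Yp) ?invr_ge0 ?(ltW Y0) // lerDr ltW.
rewrite /gauss modcM !modc_exprz.
rewrite absz_sqr.
apply: (@le_trans _ _ (modc s ^+ (`|m| * `|m|) * Y ^+ `|m|)).
  by rewrite -exprnP ler_wpM2l // exprn_ge0 // modc_ge0.
have e : Y ^+ `|m| = (Y / r ^+ 2) ^+ `|m| * r ^+ (2 * `|m|).
  by rewrite exprM -exprMn divfK // expf_neq0 // gt_eqF.
by rewrite e mulrA ler_wpM2r.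
Qed.

Let t_neq0 : t != 0.
Proof. by move: p_neq0; rewrite -tE expf_eq0. Qed.
Let rho_neq0 : rho != 0.
Proof. by move: t_neq0; rewrite -rhoE expf_eq0. Qed.
Let modc_t : modc t < 1.
Proof.
rewrite -(@ltr_pXn2r _ 2) ?nnegrE ?modc_ge0 // expr1n -modcX tE.
exact: le_lt_trans p_le r_lt1.
Qed.
Let modc_rho : modc rho < 1.
Proof. by rewrite -(@ltr_pXn2r _ 2) ?nnegrE ?modc_ge0 // expr1n -modcX rhoE. Qed.

Definition gaussN X M := \sum_(i < (2 * M).+1) gauss t X (i%:Z - M%:Z).

Lemma gaussN_bounded X : X != 0 -> modc_bounded (gaussN X).
Proof.
move=> X0; have [K K0 hK] := gauss_le t_neq0 modc_t X0.
exists (K * (2 / (1 - r))) => M.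
apply: le_trans (modc_sum _ _ _) _.
apply: le_trans (ler_wpM2l K0 (geo_sum_center r_gt0 r_lt1 M)); rewrite mulr_sumr.
apply: ler_sum => i _; apply: le_trans (hK _) _; rewrite ler_wpM2l //.
by apply: (geo_le r_gt0 r_lt1); rewrite leq_pmull.
Qed.

Lemma gaussN_close X : X != 0 ->
  geo_close r (fun M => \sum_(i < (2 * M).+1) qratio p M i * gauss t X (i%:Z - M%:Z)) (gaussN X).
Proof.
move=> X0; have [K K0 hK] := gauss_le t_neq0 modc_t X0.
have [L hL] := qratio_close.
exists (L * K * (2 / (1 - r))) => M.
rewrite -sumrB; apply: le_trans (modc_sum _ _ _) _.
have L0 : 0 <= L.
  by have := hL 0%N 0%N 0%N isT isT isT; rewrite expr0 mulr1; apply: le_trans; exact: modc_ge0.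
apply: (@le_trans _ _ (L * K * (\sum_(i < (2 * M).+1) r ^+ `|i%:Z - M%:Z|) * r ^+ M)); last first.
  by rewrite ler_wpM2r // ler_wpM2l ?mulr_ge0 // geo_sum_center.
rewrite -mulrA mulr_suml mulr_sumr; apply: ler_sum => i _.
have -> : qratio p M i * gauss t X (i%:Z - M%:Z) - gauss t X (i%:Z - M%:Z) =
   (qratio p M i - 1) * gauss t X (i%:Z - M%:Z) by ring.
have iM : (i <= 2 * M)%N by rewrite -ltnS.
rewrite modcM; apply: (@le_trans _ _ (L * r ^+ minn i (2 * M - i) *
  (K * r ^+ (2 * `|i%:Z - M%:Z|)))).
  apply: ler_pM; [exact: modc_ge0 | exact: modc_ge0 | | exact: hK].
  by apply: hL; rewrite ?geq_minl ?geq_minr.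
rewrite mulrACA ler_wpM2l ?mulr_ge0 // -!exprD.
by apply: (geo_le r_gt0 r_lt1); rewrite addnC absz_center.
Qed.

(** The translation by [2 * M] is even, so the parity of the index is that of the exponent. *)
Definition gauss_half (X : R[i]) M (e : bool) :=
  \sum_(S < (4 * M).+1 | odd S == e) gauss rho X (S%:Z - (2 * M)%:Z).

(** Rests on $2m^2+2n^2=(m+n)^2+(m-n)^2$, which is why a square root [rho] of [t] is needed. *)
Lemma gauss_mul X Y (m n : int) : X != 0 -> Y != 0 ->
  gauss t (X * Y) m * gauss t (X / Y) n = gauss rho X (m + n) * gauss rho Y (m - n).
Proof.
move=> X0 Y0; rewrite /gauss -rhoE -[rho ^+ 2]/(rho ^ 2%:Z) !exprz_exp.
rewrite !exprzMl ?unitfE ?invr_eq0 // !(exprz_inv Y) !(expfzDr _ _ X0) !(expfzDr _ _ Y0).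
transitivity (rho ^ (2%:Z * (m * m)) * rho ^ (2%:Z * (n * n)) * (X ^ m * X ^ n * Y ^ m * Y ^ (- n))).
  by ring.
rewrite -(expfzDr _ _ rho_neq0).
have -> : 2%:Z * (m * m) + 2%:Z * (n * n) = (m + n) * (m + n) + (m - n) * (m - n) by ring.
by rewrite (expfzDr _ _ rho_neq0); ring.
Qed.

(* The substitution [s = m + n, d = m - n] turns the double sum over a square into
   a sum over pairs [(s, d)] of equal parity, which has rank two; only terms far from
   the origin are lost by truncating to a square in [(s, d)]. *)
Lemma gaussN_rank2 X Y : X != 0 -> Y != 0 ->
  geo_close r (fun M => gaussN (X * Y) M * gaussN (X / Y) M)
    (fun M => gauss_half X M false * gauss_half Y M false +
      gauss_half X M true * gauss_half Y M true).
Proof.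
move=> X0 Y0.
have [K K0 hK] := gauss_le rho_neq0 modc_rho X0.
have [L L0 hL] := gauss_le rho_neq0 modc_rho Y0.
exists (K * L * (2 / (1 - r)) ^+ 2) => M.
pose F (w : 'I_(4 * M).+1 * 'I_(4 * M).+1) :=
  gauss rho X (w.1%:Z - (2 * M)%:Z) * gauss rho Y (w.2%:Z - (2 * M)%:Z).
pose inr (w : 'I_(4 * M).+1 * 'I_(4 * M).+1) :=
  [&& 2 * M <= w.1 + w.2, w.1 + w.2 <= 6 * M, w.2 <= w.1 + 2 * M & w.1 <= w.2 + 2 * M]%N.
pose par (w : 'I_(4 * M).+1 * 'I_(4 * M).+1) := odd w.1 == odd w.2.
have e1 : gauss_half X M false * gauss_half Y M false + gauss_half X M true * gauss_half Y M true =
    \sum_(w | par w) F w.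
  have h e : gauss_half X M e * gauss_half Y M e = \sum_(w | par w && (odd w.1 == e)) F w.
    rewrite /gauss_half big_distrlr /= pair_big /=; apply: eq_bigl => -[S D] /=.
    by rewrite /par /=; case: (odd S); case: (odd D); case: e.
  rewrite !h [RHS](bigID (fun w : 'I_(4 * M).+1 * 'I_(4 * M).+1 => odd w.1 == false)) /=.
  by congr (_ + _); apply: eq_bigl => w; case: (odd w.1).
have e2 : gaussN (X * Y) M * gaussN (X / Y) M = \sum_(w | par w && inr w) F w.
  rewrite /gaussN big_distrlr /= pair_big /=.
  rewrite -(@sum_square_parity _ M (fun S D =>
    gauss rho X (S%:Z - (2 * M)%:Z) * gauss rho Y (D%:Z - (2 * M)%:Z))).
  apply: eq_bigr => v _; rewrite gauss_mul //.
  have := ltn_ord v.2; move: (v.1 : nat) (v.2 : nat) => i j jM.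
  by congr (gauss _ _ _ * gauss _ _ _); clear -jM; lia.
rewrite e1 e2 [X in _ - X](bigID inr) /= opprD addrA subrr add0r modcN.
apply: le_trans (modc_sum _ _ _) _.
pose G (S : 'I_(4 * M).+1) := r ^+ `|S%:Z - (2 * M)%:Z|.
have GE : \sum_S G S <= 2 / (1 - r).
  have := geo_sum_center r_gt0 r_lt1 (2 * M); rewrite /G.
  by rewrite mulnA.
apply: (@le_trans _ _ (\sum_(w : 'I_(4 * M).+1 * 'I_(4 * M).+1) K * L * r ^+ M * (G w.1 * G w.2))).
  rewrite [leLHS]big_mkcond /=; apply: ler_sum => w _.
  have p0 : 0 <= K * L * r ^+ M * (G w.1 * G w.2) by rewrite /G !mulr_ge0 ?geo0.
  case: ifP => // /andP[_ nw].
  rewrite modcM; apply: le_trans (ler_pM (modc_ge0 _) (modc_ge0 _) (hK _) (hL _)) _.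
  rewrite mulrACA -[leRHS]mulrA ler_wpM2l ?mulr_ge0 // /G -!exprD.
  by apply: (geo_le r_gt0 r_lt1); exact: absz_outside.
rewrite -mulr_sumr.
have -> : \sum_(w : 'I_(4 * M).+1 * 'I_(4 * M).+1) G w.1 * G w.2 = (\sum_S G S) ^+ 2.
  by rewrite expr2 big_distrlr /= pair_big.
rewrite mulrAC ler_wpM2r // ler_wpM2l ?mulr_ge0 //.
have g0 : 0 <= \sum_S G S by apply: sumr_ge0 => S _; apply: geo0.
by rewrite lerXn2r ?nnegrE ?divr_ge0 // ltW.
Qed.

End Plucker.

(** * Weierstrass' three-term relation *)

Section ThreeTerm.
Variables (R : realType) (p : R[i]).
Hypothesis p_lt1 : `|p| < 1.

Lemma modc_radius : exists r, [/\ 0 < r, r < 1 & modc p <= r].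
Proof.
have p1 : modc p < 1 by rewrite -ltcR -modcE.
(* The value 1/2 keeps the radius positive when [p] is 0. *)
exists (Num.max (modc p) 2^-1); rewrite lt_max gt_max p1 le_max lexx; split=> //.
  by apply/orP; right; lra.
by rewrite /=; lra.
Qed.

Lemma theta_inv x : x != 0 -> theta p x^-1 = - x^-1 * theta p x.
Proof. by have [r [r0 r1 pr]] := modc_radius; apply: (thetaV r0 r1 pr). Qed.

(** Only the combination is claimed to converge, not the four families separately; this is enough to
    pass polynomial identities to the limit. *)
Lemma thetaN_rank2 : p != 0 -> exists (A0 A1 B0 B1 : R[i] -> nat -> R[i]),
  forall x y, x != 0 -> y != 0 ->
    (fun M => A0 x M * B0 y M + A1 x M * B1 y M : R[i]^o) @ \oo
      --> (theta p (x * y) * theta p (x / y) : R[i]^o).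
Proof.
move=> p0; have [r [r0 r1 pr]] := modc_radius.
pose t : R[i] := sqrtC (p : R[i]); pose rho : R[i] := sqrtC (t : R[i]).
have tE : t ^+ 2 = p by apply: sqrtCK.
have rhoE : rho ^+ 2 = t by apply: sqrtCK.
have t0 : t != 0 by rewrite sqrtC_eq0.
pose C M := qfact p (2 * M) / qfact p M ^+ 2.
have Cb : modc_bounded C.
  have [K hK] := qfact_bounded r0 r1 pr; have [L hL] := qfactV_bounded r0 r1 pr.
  exists (K * (L * L)) => M; rewrite /C modcM expr2 invfM modcM.
  by rewrite ler_pM ?mulr_ge0 ?modc_ge0 // ler_pM ?modc_ge0.
exists (fun x M => C M ^+ 2 * gauss_half rho (- (x / t)) M false),
  (fun x M => C M ^+ 2 * gauss_half rho (- (x / t)) M true),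
  (fun y M => gauss_half rho y M false), (fun y M => gauss_half rho y M true) => x y x0 y0.
have X0 : - (x / t) != 0 by rewrite oppr_eq0 mulf_neq0 ?invr_eq0.
have xy0 : x * y != 0 by rewrite mulf_neq0.
have xy0' : x / y != 0 by rewrite mulf_neq0 ?invr_eq0.
pose E (z : R[i]) M : R[i] :=
  \sum_(i < (2 * M).+1) qratio p M i * gauss t (- (z / t)) (i%:Z - M%:Z).
have tN z M : z != 0 -> thetaN p z M = C M * E z M.
  move=> z0; rewrite /thetaN /C /E -tE triple_product // => k.
  by rewrite tE; apply: (qfact_neq0 r0 r1 pr).
have e1 : - (x * y / t) = - (x / t) * y by ring.
have e2 : - (x / y / t) = - (x / t) / y by ring.
have XY0 : - (x * y / t) != 0 by rewrite oppr_eq0 mulf_neq0 ?invr_eq0.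
have XY0' : - (x / y / t) != 0 by rewrite oppr_eq0 mulf_neq0 ?invr_eq0.
have c1 : geo_close r (E (x * y)) (gaussN t (- (x * y / t))).
  exact (gaussN_close r0 r1 pr p0 tE XY0).
have c2 : geo_close r (E (x / y)) (gaussN t (- (x / y / t))).
  exact (gaussN_close r0 r1 pr p0 tE XY0').
have b1 := gaussN_bounded r0 r1 pr p0 tE XY0.
have b2 := gaussN_bounded r0 r1 pr p0 tE XY0'.
have rk := gaussN_rank2 r0 r1 pr p0 tE rhoE X0 y0; rewrite -e1 -e2 in rk.
have c3 := geo_close_trans (geo_closeMM b1 (geo_close_bounded r0 r1 c2 b2) c1 c2) rk.
clearbody E.
have cl : geo_close r (fun M => thetaN p (x * y) M * thetaN p (x / y) M)
  (fun M => C M ^+ 2 * gauss_half rho (- (x / t)) M false * gauss_half rho y M false +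
    C M ^+ 2 * gauss_half rho (- (x / t)) M true * gauss_half rho y M true).
  have [K hK] := geo_closeM (modc_boundedM Cb Cb) c3.
  exists K => M; apply: le_trans (hK M); rewrite le_eqVlt; apply/orP; left; apply/eqP.
  rewrite (tN _ M xy0) (tN _ M xy0'); congr modc.
  move: (C M) (gauss_half _ _ M false) (gauss_half _ _ M true) => c g0 g1.
  move: (gauss_half _ _ M false) (gauss_half _ _ M true) => g2 g3.
  by move: (E _ M) (E _ M) => S1 S2; ring.
have [K hK] := cl.
apply: (cvg_geo_close r0 r1 hK).
apply: (@cvgM R[i] _ _ _ (thetaN p (x * y)) (thetaN p (x / y))); exact: (thetaN_cvg r0 r1 pr).
Qed.

(** The minors of order 3 of a kernel of rank two vanish for each [M], hence also in the limit. *)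
Lemma theta_det3 (x y : 'I_3 -> R[i]) : p != 0 -> (forall i, x i != 0) -> (forall i, y i != 0) ->
  let g i j := theta p (x i * y j) * theta p (x i / y j) in
  forall i0 i1 i2 j0 j1 j2,
  g i0 j0 * (g i1 j1 * g i2 j2 - g i1 j2 * g i2 j1)
  - g i0 j1 * (g i1 j0 * g i2 j2 - g i1 j2 * g i2 j0)
  + g i0 j2 * (g i1 j0 * g i2 j1 - g i1 j1 * g i2 j0) = 0.
Proof.
move=> p0 x0 y0 g i0 i1 i2 j0 j1 j2; have [A0 [A1 [B0 [B1 h]]]] := thetaN_rank2 p0.
pose G i j M : R[i]^o := A0 (x i) M * B0 (y j) M + A1 (x i) M * B1 (y j) M.
have hG i j : G i j @ \oo --> (g i j : R[i]^o) by apply: h.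
have hM i j k l i' j' : (fun M => G i j M * (G k l M * G i' j' M) : R[i]^o) @ \oo -->
    (g i j * (g k l * g i' j') : R[i]^o).
  apply: (@cvgM R[i] _ _ _ (G i j) (fun M => G k l M * G i' j' M)) => //.
  exact: (@cvgM R[i] _ _ _ (G k l) (G i' j')).
have hB i a b c d a' b' c' d' k :
    (fun M => G i k M * (G a b M * G c d M) - G i k M * (G a' b' M * G c' d' M) : R[i]^o)
      @ \oo -->
    (g i k * (g a b * g c d) - g i k * (g a' b' * g c' d') : R[i]^o).
  exact: (@cvgB R[i] R[i]^o _ _ _ (fun M => G i k M * (G a b M * G c d M))
    (fun M => G i k M * (G a' b' M * G c' d' M))).
pose F M : R[i]^o :=
  (G i0 j0 M * (G i1 j1 M * G i2 j2 M) - G i0 j0 M * (G i1 j2 M * G i2 j1 M))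
  - (G i0 j1 M * (G i1 j0 M * G i2 j2 M) - G i0 j1 M * (G i1 j2 M * G i2 j0 M))
  + (G i0 j2 M * (G i1 j0 M * G i2 j1 M) - G i0 j2 M * (G i1 j1 M * G i2 j0 M)).
have hF : F @ \oo --> (
  (g i0 j0 * (g i1 j1 * g i2 j2) - g i0 j0 * (g i1 j2 * g i2 j1))
  - (g i0 j1 * (g i1 j0 * g i2 j2) - g i0 j1 * (g i1 j2 * g i2 j0))
  + (g i0 j2 * (g i1 j0 * g i2 j1) - g i0 j2 * (g i1 j1 * g i2 j0)) : R[i]^o).
  exact (@cvgD R[i] R[i]^o _ _ _ _ _ _ _
  (@cvgB R[i] R[i]^o _ _ _ _ _ _ _ (hB i0 i1 j1 i2 j2 i1 j2 i2 j1 j0)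
    (hB i0 i1 j0 i2 j2 i1 j2 i2 j0 j1))
  (hB i0 i1 j0 i2 j1 i1 j1 i2 j0 j2)).
have h0 : F @ \oo --> (0 : R[i]^o).
  have -> : F = (fun=> 0) by apply/funext => M; rewrite /F /G; ring.
  exact: cvg_cst.
have := cvg_unique _ hF h0; clear; move: g => g e.
by rewrite !mulrBr; apply: e.
Qed.

Lemma theta_plucker x y u v : x != 0 -> y != 0 -> u != 0 -> v != 0 ->
  thpm (theta p) x y / x * (thpm (theta p) u v / u)
  - thpm (theta p) x u / x * (thpm (theta p) y v / y)
  + thpm (theta p) x v / x * (thpm (theta p) y u / y) = 0.
Proof.
move=> x0 y0 u0 v0.
(* For [p = 0] the square root [t] is 0 and the Laurent terms make no sense, but theta is then
   [1 - z] and the relation is rational. *)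
have [p0|p0] := eqVneq p 0.
  have th0 z : theta p z = 1 - z.
    have [r [r0 r1 pr]] := modc_radius.
    have c : thetaN p z @ \oo --> (1 - z : R[i]^o).
      apply: (@cvg_geo_close R r r0 r1 (fun=> 1 - z) (thetaN p z) (1 - z) (modc z));
        last exact: cvg_cst.
      case=> [|n].
        rewrite /thetaN big_ord0 expr0 mulr1.
        by rewrite (_ : 1 - z - 1 = - z) ?modcN ?lexx //; ring.
      have -> : thetaN p z n.+1 = 1 - z.
        rewrite /thetaN big_ord_recl p0 expr0 expr1 mul1r mul0r subr0 mulr1.
        rewrite [X in _ * X](_ : _ = 1) ?mulr1 //; apply: big1 => i _.
        by rewrite lift0 !exprS !mul0r !subr0 mulr1.
      by rewrite subrr modc0 mulr_ge0 ?modc_ge0 ?geo_ge0.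
    by have h1 := @thetaN_cvg R p r r0 r1 pr z; apply: (cvg_unique _ h1 c).
  by rewrite /thpm !th0; field; rewrite x0 y0 u0 v0.
pose G a b := thpm (theta p) a b / a.
have GC a b : a != 0 -> b != 0 -> G b a = - G a b.
  by move=> a0 b0; rewrite /G (@thpmC _ _ theta_inv _ _ a0 b0); field; rewrite a0 b0.
have Gaa a : a != 0 -> G a a = 0.
  by move=> a0; rewrite /G /thpm divff // (th1 theta_inv) mulr0 mul0r.
have det a b c d e f : a != 0 -> b != 0 -> c != 0 -> d != 0 -> e != 0 -> f != 0 ->
    G a d * (G b e * G c f - G b f * G c e) - G a e * (G b d * G c f - G b f * G c d)
    + G a f * (G b d * G c e - G b e * G c d) = 0.
  move=> a0 b0 c0 d0 e0 f0.
  pose X (i : 'I_3) := [:: a; b; c]`_i; pose Y (i : 'I_3) := [:: d; e; f]`_i.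
  have X0 i : X i != 0 by case: i => -[|[|[|]]].
  have Y0 i : Y i != 0 by case: i => -[|[|[|]]].
  have := @theta_det3 X Y p0 X0 Y0 0 1 2%:R 0 1 2%:R.
  rewrite /X /Y /= -!/(thpm (theta p) _ _) => h; rewrite /G.
  transitivity ((a * b * c)^-1 * 0); last by rewrite mulr0.
  rewrite -[X in _ = _ * X]h; move: (thpm _ a d) (thpm _ a e) (thpm _ a f) (thpm _ b d)
    (thpm _ b e) (thpm _ b f) (thpm _ c d) (thpm _ c e) (thpm _ c f) => *.
  by field; rewrite a0 b0 c0.
rewrite -!/(G _ _).
(* The minor with rows [a, b, c] and columns [a, b, d] of an antisymmetric kernel
   is [G a b] times the Pfaffian. *)
have pl a b c d : a != 0 -> b != 0 -> c != 0 -> d != 0 ->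
    G a b * (G a b * G c d - G a c * G b d + G a d * G b c) = 0.
  move=> a0 b0 c0 d0; rewrite -(det a b c a b d a0 b0 c0 a0 b0 d0) !Gaa //.
  by rewrite (GC a c) // (GC a b) // (GC b c) //; ring.
(* Three orderings give the same Pfaffian up to sign, multiplied by [G x y], [G x u] and [G x v].
   Were it nonzero, these three entries would vanish, and with them every term of the Pfaffian. *)
have h1 := pl x y u v x0 y0 u0 v0.
have h2 := pl x u y v x0 u0 y0 v0.
have h3 := pl x v y u x0 v0 y0 u0.
have Exy := GC y u y0 u0; have Eyv := GC y v y0 v0; have Euv := GC u v u0 v0.
rewrite Exy in h2; rewrite Eyv Euv in h3.
apply/eqP/negPn/negP => nz.
have a1 : G x y = 0 by move/eqP: h1; rewrite mulf_eq0 (negbTE nz) orbF => /eqP.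
have a2 : G x u = 0.
  move/eqP: h2; rewrite mulf_eq0 => /orP[/eqP //|/eqP h]; case/eqP: nz.
  by rewrite -[RHS]oppr0 -h; ring.
have a3 : G x v = 0.
  move/eqP: h3; rewrite mulf_eq0 => /orP[/eqP //|/eqP h]; case/eqP: nz.
  by rewrite -[RHS]h; ring.
by case/eqP: nz; rewrite a1 a2 a3 !mul0r subrr addr0.
Qed.

End ThreeTerm.

Local Close Scope classical_set_scope.

Theorem theorem6p1 (R : realType) (p q : R[i]) (n N : nat)
    (a : 'I_n.-1 -> R[i]) (b : R[i]) (z : 'I_n -> R[i])
    (p_lt1 : `|p| < 1) (q_neq0 : q != 0) (n_gt0 : (0 < n)%N)
    (a_neq0 : forall j, a j != 0) (b_neq0 : b != 0)
    (z_neq0 : forall k, z k != 0)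
    (vandermonde_neq0 : vandermonde p z != 0)
    (lhs_denom_neq0 : forall y : {ffun 'I_n -> 'I_N.+1},
      (\sum_(k < n) y k)%N = N ->
      [/\ forall j k : 'I_n, (j < k)%N ->
            epoch p q (z j * z k) (y j + y k) != 0,
          forall k, epoch p q (b * z k) (y k) != 0,
          forall k, epoch p q (q ^ (1 - N%:Z) * z k / b) (y k) != 0
        & forall j k, epoch p q (q * z k / z j) (y k) != 0])
    (rhs_denom_neq0 :
      [/\ epoch p q q N != 0,
          forall k, epoch p q (b * z k) N != 0
        & forall k, epoch p q (b / z k) N != 0]) :
  \sum_(y : {ffun 'I_n -> 'I_N.+1} | (\sum_(k < n) y k)%N == N)
     (vandermonde p (fun k => z k * q ^+ y k) / vandermonde p z
      * (\prod_(j < n) \prod_(k < n | (j < k)%N)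
           (1 / epoch p q (z j * z k) (y j + y k)))
      * \prod_(k < n)
          (q ^+ 'C(y k, 2) * z k ^+ y k
           * (\prod_(j < n.-1)
                (epoch p q (z k * a j) (y k) * epoch p q (z k / a j) (y k)))
           / (epoch p q (b * z k) (y k)
              * epoch p q (q ^ (1 - N%:Z) * z k / b) (y k)
              * \prod_(j < n) epoch p q (q * z k / z j) (y k))))
  = (- (q ^ (N%:Z - 1) * b)) ^+ N
    * (\prod_(k < n.-1) (epoch p q (b * a k) N * epoch p q (b / a k) N))
    / (epoch p q q N
       * \prod_(k < n) (epoch p q (b * z k) N * epoch p q (b / z k) N)).
Proof.
have thV := @theta_inv R p p_lt1; have thP := @theta_plucker R p p_lt1.
have [epq_neq0 epb_neq0 epb'_neq0] := rhs_denom_neq0.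
(* Concentrating [N] at one index makes the Pochhammer symbols as long as possible, so these indices
   alone yield the conditions of [generic] on products and on ratios with positive exponent;
   exponent 0 comes from the Vandermonde determinant. *)
pose top (j : 'I_n) : {ffun 'I_n -> 'I_N.+1} := [ffun k => if k == j then ord_max else ord0].
have topj j : top j j = N :> nat by rewrite ffunE eqxx.
have topk j k : k != j -> top j k = 0%N :> nat by move=> kj; rewrite ffunE (negbTE kj).
have top_sum j : (\sum_(k < n) top j k)%N = N.
  by rewrite (bigD1 j) //= topj big1 ?addn0 // => k; apply: topk.
have epochP x m i : epoch p q x m != 0 -> (i < m)%N -> theta p (x * q ^+ i) != 0.
  by move=> /prodf_neq0 h im; apply: (h (Ordinal im)).
have ratio0 (j k : 'I_n) : j != k -> theta p (z j / z k) != 0.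
  have lt0 (i l : 'I_n) : (i < l)%N -> theta p (z l / z i) != 0.
    move=> il; have /prodf_neq0 /(_ i isT) /prodf_neq0 /(_ l il) := vandermonde_neq0.
    by rewrite mulf_eq0 negb_or => /andP[].
  rewrite -val_eqE neq_ltn => /orP[/lt0 | /lt0 //].
  exact: (th_div_neq0 thV).
have gz : generic (theta p) q N z.
  split=> // [i /andP[i0 iN] | j k jk i iN | j k jk [|i] iN].
  - by rewrite -(prednK i0) exprS; apply: epochP epq_neq0 _; rewrite prednK.
  - have [+ _ _ _] := lhs_denom_neq0 _ (top_sum j).
    move: jk; rewrite -val_eqE neq_ltn => /orP[jk | kj] h.
      have := h _ _ jk; rewrite topj topk ?addn0; last by rewrite -val_eqE gtn_eqF.
      by move/epochP; apply.
    have := h _ _ kj; rewrite topj topk ?add0n; last by rewrite -val_eqE ltn_eqF.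
    by rewrite (mulrC (z j)); move/epochP; apply.
  - by rewrite expr0 mulr1 ratio0.
  - have [_ _ _ /(_ k j)] := lhs_denom_neq0 _ (top_sum j); rewrite topj => /epochP /(_ iN).
    by congr (theta p _ != 0); rewrite exprS; ring.
pose s := [seq a j | j <- index_enum 'I_n.-1].
have ns : n = (size s).+1.
  by rewrite size_map -[index_enum _]enumT size_enum_ord prednK.
have s0 : all (fun x => x != 0) s by apply/allP => x /mapP[j _ ->].
have prods (F : R[i] -> R[i]) : \prod_(j < n.-1) F (a j) = \prod_(x <- s) F x.
  by rewrite big_map.
have epE : epoch p q = poch (theta p) q by [].
rewrite /vandermonde epE in epb_neq0 epb'_neq0 *.
move: {epE epochP ratio0 vandermonde_neq0 lhs_denom_neq0 rhs_denom_neq0 epq_neq0}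
  (theta p) thV thP gz epb_neq0 epb'_neq0 => th thV thP gz pb pb'.
rewrite (eq_bigr (fun y : {ffun 'I_n -> 'I_N.+1} =>
   (- (q ^ (N%:Z - 1) * b)) ^+ N /
   \prod_(k < n) (poch th q (b * z k) N * poch th q (b / z k) N) *
   (coefD th q s (fun k => y k) z * coefW th q N b (fun k => y k) z))); last first.
  move=> y /eqP yN; rewrite -(@term_coef _ _ thV q q_neq0 n s N b (fun k => y k) z) //.
  congr (_ * _); apply: eq_bigr => k _.
  by rewrite (prods (fun x => poch th q (z k * x) (y k) * poch th q (z k / x) (y k))).
rewrite -mulr_sumr (multisum thV thP q_neq0 (leqnn N) ns s0 gz b_neq0).
by rewrite (prods (fun x => poch th q (b * x) N * poch th q (b / x) N)) invfM; ring.
Qed.
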